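(* Let $X_n$ be the random variable giving the value of $\mathrm{ds}_{\ulcorner}(\lambda)$ of a uniformly random partition $\lambda\in\mathcal P^\Box_n$ (respectively, of a uniformly random partition $\lambda$ with $\max\{\lambda_1,\lambda'_1\}=n$). In each of these two cases, the sequence $X_n$ has a Rayleigh limiting distribution; specifically, as $n\to\infty$, $$\frac{X_n}{\sqrt{n}}\stackrel{d}{\to}\mathcal R\left(\frac{1}{2\sqrt{2}}\right),$$ which has density function $8xe^{-4x^2}$ for $x\ge0$, and $$\mathbb{E} X_n=\frac{\sqrt{\pi}}{4}\sqrt{n}+O(1),\qquad \mathbb{V} X_n=\left(\frac{1}{4}-\frac{\pi}{16}\right)n+O(\sqrt{n}),$$ $$\mathbb{P}(X_n=k)=\frac{8k}{n}e^{-4k^2/n}+O((k+1)n^{-3/2})+O(n^{-1})$$ uniformly for all integers $k\ge0$.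
   Context: An integer partition is a sequence $\lambda=(\lambda_1,\dots,\lambda_k)$ with $k\ge0$ and $\lambda_1\ge\dots\ge\lambda_k\ge1$ (for the empty partition $\lambda_1=\lambda_1'=0$). $\lambda'$ is the conjugate partition, with $\lambda'_i=|\{j:\lambda_j\ge i\}|$; $\lambda_1'$ is the number of parts of $\lambda$. For $n\ge0$, $\mathcal P^\Box_n$ is the set of partitions with $k\le n$ parts and $\lambda_1\le n$. The boxes of the Young diagram of $\lambda$ decompose into diagonal hooks: the first hook consists of the first row and the first column; the second hook is the largest hook (first row and first column) after the first hook has been removed, and so on; the number of hooks is the largest $\delta$ with $\lambda_\delta\ge\delta$. The statistic $\mathrm{ds}_{\ulcorner}(\lambda)$ is the number of these diagonal hooks that are self-conjugate, i.e. have the same number of boxes in their row as in their column. $\mathcal R(\sigma)$ denotes the Rayleigh distribution with density $\frac{x}{\sigma^2}e^{-x^2/2\sigma^2}$ for $x\ge0$; $\stackrel{d}{\to}$ denotes convergence in distribution; $\mathbb{E}$ and $\mathbb{V}$ denote expected value and variance. *)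

(* Defs.v *)
From HB Require Import structures.
From mathcomp Require Import all_boot all_order all_algebra.
From mathcomp Require Import all_classical all_reals all_analysis.
From mathcomp Require Import measurable_realfun.
From mathcomp Require Import ring.

Set Implicit Arguments.
Unset Strict Implicit.
Unset Printing Implicit Defensive.

Import Order.TTheory GRing.Theory Num.Theory.
Import numFieldNormedType.Exports.

Local Open Scope classical_set_scope.
Local Open Scope ring_scope.

Section partitions.
Local Open Scope nat_scope.

Definition is_part (s : seq nat) := sorted geq s && all (leq 1) s.

Record intpart := IntPart { parts :> seq nat; partsP : is_part parts }.

HB.instance Definition _ := [isSub for parts].
HB.instance Definition _ := [Choice of intpart by <:].

Definition empty_part : intpart := @IntPart [::] isT.

HB.instance Definition _ := isPointed.Build intpart empty_part.

(* [part s i] is $\lambda_i$ and [conj_part s i] is $\lambda'_i$, both for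
   $i \ge 1$ (1-based), with value 0 beyond the last part. *)
Definition part (s : seq nat) (i : nat) := nth 0 s i.-1.

Definition conj_part (s : seq nat) (i : nat) := count (leq i) s.

Definition box_part (n : nat) : set intpart :=
  [set l | size l <= n /\ part l 1 <= n].

Definition max_part (n : nat) : set intpart :=
  [set l | maxn (part l 1) (conj_part l 1) = n].

(* What remains of a Young diagram once its first row and its first column have
   been removed. *)
Definition peel (s : seq nat) : seq nat :=
  [seq x <- [seq y.-1 | y <- behead s] | 0 < x].

(* The largest $\delta$ with $\lambda_\delta \ge \delta$. The term $\delta = 0$
   is always admissible, so the value is 0 when no $\delta \ge 1$ qualifies. *)
Definition num_hooks (s : seq nat) : nat :=
  \max_(d < (size s).+1 | d <= part s d) d.

(* The row and the column of the [i]-th diagonal hook (0-based) are the first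
   row and the first column of the [i]-fold peeled diagram; both contain the
   corner box. *)
Definition hook_row (s : seq nat) (i : nat) := part (iter i peel s) 1.

Definition hook_col (s : seq nat) (i : nat) := size (iter i peel s).

Definition ds (s : seq nat) : nat :=
  #|[pred i : 'I_(num_hooks s) | hook_row s i == hook_col s i]|.

End partitions.

Section discrete_partitions.

HB.instance Definition _ := @isMeasurable.Build default_measure_display
  intpart discrete_measurable discrete_measurable0
  discrete_measurableC discrete_measurableU.

Lemma measurable_part (A : set intpart) : measurable A.
Proof. by []. Qed.

Lemma box_part_neq0 n : box_part n !=set0.
Proof. by exists empty_part. Qed.

Lemma max_part_neq0 n : max_part n !=set0.
Proof.
case: n => [|n]; first by exists empty_part.
have h : is_part [:: n.+1] by [].
by exists (IntPart h); rewrite /max_part/= /part /conj_part/=; apply/maxn_idPl.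
Qed.

Lemma conj_part1 (l : intpart) : conj_part l 1 = size l.
Proof. by case: l => s /= /andP[_]; rewrite all_count => /eqP. Qed.

Lemma max_part_sub_box n : max_part n `<=` box_part n.
Proof.
by move=> l /= <-; rewrite conj_part1; split; [exact: leq_maxr|exact: leq_maxl].
Qed.

Lemma finite_box_part n : finite_set (box_part n).
Proof.
pose f (l : intpart) := [ffun i : 'I_n => inord (nth 0%N l i) : 'I_n.+1].
have le1 (l : intpart) i : (nth 0 l i <= part l 1)%N.
  have [li|li] := ltnP i (size l); last by rewrite nth_default.
  have /andP[sl _] := partsP l.
  have geqT : transitive geq by move=> y u v /= uy yv; exact: leq_trans yv uy.
  apply: (sorted_leq_nth geqT leqnn 0%N sl 0 i) => //.
  by rewrite inE (leq_ltn_trans _ li).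
have fI : {in box_part n &, injective f}.
  move=> l m; rewrite !inE => -[sl ml] [sm mm] /ffunP fE.
  have nthE i : nth 0%N l i = nth 0%N m i.
    have [ni|ni] := leqP n i.
      by rewrite !nth_default// (leq_trans _ ni).
    have /(congr1 val) := fE (Ordinal ni); rewrite !ffunE/= !inordK//.
    - by rewrite ltnS (leq_trans (le1 _ _)).
    - by rewrite ltnS (leq_trans (le1 _ _)).
  have szE (u v : intpart) : (forall i, nth 0%N u i = nth 0%N v i) ->
      (size u <= size v)%N.
    move=> uv; rewrite leqNgt; apply/negP => vu.
    have /andP[_ /allP/(_ _ (mem_nth 0%N vu))] := partsP u.
    by rewrite uv nth_default.
  apply: val_inj; apply: (@eq_from_nth _ 0%N) => [|i _]; last exact: nthE.
  by apply/eqP; rewrite eqn_leq !szE.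
have : finite_set (f @` box_part n) by exact: finite_finset.
by rewrite (eq_finite_set (inj_card_eq fI)).
Qed.

Lemma finite_max_part n : finite_set (max_part n).
Proof. exact: sub_finite_set (@max_part_sub_box n) (finite_box_part n). Qed.

End discrete_partitions.

Section uniform_partition.
Context (R : realType).

(* Counting measure restricted to [A] and normalized; the Dirac mass is only the
   default value of [mnormalize], used when [A] is empty or infinite. *)
Definition uniform_part (A : set intpart) : probability intpart R :=
  mnormalize (mrestr counting (measurable_part A)) (dirac empty_part).

Definition ds_rv (l : intpart) : R := (ds l)%:R.

Lemma measurable_ds_rv : measurable_fun [set: intpart] ds_rv.
Proof. by []. Qed.

HB.instance Definition _ :=
  isMeasurableFun.Build _ _ _ _ ds_rv measurable_ds_rv.

End uniform_partition.

Section rayleigh.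
Context {R : realType}.
Variable sigma : R.
Notation mu := lebesgue_measure.

Let pdfT (x : R) := x / sigma ^+ 2 * expR (- x ^+ 2 / (2 * sigma ^+ 2)).

Definition rayleigh_pdf := pdfT \_ `[0, +oo[.

Definition rayleigh_prob (V : set R) : \bar R :=
  (\int[mu]_(x in V) (rayleigh_pdf x)%:E)%E.

Lemma rayleigh_pdf_ge0 x : 0 <= rayleigh_pdf x.
Proof.
apply: restrict_ge0 => {}x; rewrite /= in_itv/= andbT => x0.
by rewrite mulr_ge0 ?expR_ge0// divr_ge0// sqr_ge0.
Qed.

Let continuous_gauss :
  continuous (fun x : R => expR (- x ^+ 2 / (2 * sigma ^+ 2))).
Proof.
move=> x; apply: continuous_comp; last exact: continuous_expR.
apply: cvgMl; apply: (@cvgN _ R^o); exact: exprn_continuous.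
Qed.

Let continuous_pdfT : continuous pdfT.
Proof.
move=> x; apply: cvgM; last exact: continuous_gauss.
by apply: cvgMl; exact: cvg_id.
Qed.

Lemma measurable_rayleigh_pdf : measurable_fun [set: R] rayleigh_pdf.
Proof.
apply/measurable_restrict => //; apply: measurable_funTS.
exact: continuous_measurable_fun.
Qed.

Let rayleigh0 : rayleigh_prob set0 = 0%E.
Proof. by rewrite /rayleigh_prob integral_set0. Qed.

Let rayleigh_ge0 A : (0 <= rayleigh_prob A)%E.
Proof. by apply: integral_ge0 => x _; rewrite lee_fin rayleigh_pdf_ge0. Qed.

Let rayleigh_sigma_additive : semi_sigma_additive rayleigh_prob.
Proof.
move=> /= F mF tF mUF; rewrite /rayleigh_prob; apply: cvg_toP.
  apply: ereal_nondecreasing_is_cvgn => m n mn.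
  apply: lee_sum_nneg_natr => // k _ _; apply: integral_ge0 => /= x Fkx.
  by rewrite lee_fin rayleigh_pdf_ge0.
rewrite ge0_integral_bigcup//=.
- by apply/measurable_funTS/measurableT_comp => //; exact: measurable_rayleigh_pdf.
- by move=> x _; rewrite lee_fin rayleigh_pdf_ge0.
Qed.

HB.instance Definition _ := isMeasure.Build _ _ _
  rayleigh_prob rayleigh0 rayleigh_ge0 rayleigh_sigma_additive.

Lemma rayleigh_prob_setT : sigma != 0 -> rayleigh_prob [set: R] = 1%E.
Proof.
move=> s0; have s2 : 0 < 2 * sigma ^+ 2 by rewrite mulr_gt0// exprn_even_gt0.
have -> : rayleigh_prob [set: R] = (\int[mu]_(x in `[0%R, +oo[) (pdfT x)%:E)%E.
  rewrite /rayleigh_prob [RHS]integral_mkcond; apply: eq_integral => x _.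
  by rewrite /rayleigh_pdf !patchE; case: ifP.
pose F (x : R) := - expR (- x ^+ 2 / (2 * sigma ^+ 2)).
have dF (x : R) : is_derive x 1 F (pdfT x).
  rewrite /F.
  have dq : is_derive x 1 (fun y : R => - y ^+ 2 / (2 * sigma ^+ 2))
      (- x / sigma ^+ 2).
    rewrite (_ : (fun _ => _) =
      ((- (2 * sigma ^+ 2)^-1) \*: (@GRing.exp R ^~ 2))); last first.
      by apply/funext => y /=; rewrite /GRing.scale/=; ring.
    apply: is_derive_eq; rewrite /GRing.scale/=; field.
    by [].
  have := is_deriveN (is_derive1_comp (is_derive_expR _) dq).
  move=> /is_derive_eq; apply; rewrite /pdfT; ring.
rewrite (@ge0_continuous_FTC2y _ pdfT F 0 0)//.
- by rewrite /F expr0n/= oppr0 mul0r expR0 -EFinB opprK add0r.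
- by move=> x x0; rewrite /pdfT mulr_ge0 ?expR_ge0// divr_ge0// sqr_ge0.
- exact: continuous_subspaceT.
- rewrite -oppr0; apply: cvgN.
  have -> : (fun x : R => expR (- x ^+ 2 / (2 * sigma ^+ 2))) =
      (fun y => expR (- y)) \o (fun x => (2 * sigma ^+ 2)^-1 * x ^+ 2).
    by apply/funext => x /=; rewrite mulNr mulrC.
  apply: (@cvg_comp _ _ _ _ _ _ (pinfty_nbhs R)); last exact: cvgr_expR.
  by apply: gt0_cvgMry; [rewrite invr_gt0|exact: cvgr_expr2].
- apply: cvg_at_right_filter; apply: cvgN; exact: continuous_gauss.
- by move=> x _; rewrite derive1E; case: (dF x).
Qed.

End rayleigh.

(* [mu] is the law of the limit: pointwise convergence of the distribution
   functions at the continuity points of the distribution function of [mu]. *)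
Definition cvg_in_distribution d (T : measurableType d) (R : realType)
    (P : nat -> probability T R) (X : forall n, {RV (P n) >-> R})
    (mu : {measure set R -> \bar R}) :=
  forall x : R, {for x, continuous (fun y : R => mu `]-oo, y]%classic)} ->
    cdf (X n) x @[n --> \oo] --> mu `]-oo, x]%classic.

(* Main.v *)
(* The partitions in a p x q box satisfy a Pascal-type recursion obtained by
   stripping the outermost diagonal hook, in which the self-conjugate hooks put a
   weight u on the diagonal p = q. Hence the generating polynomials
   G_n(u) of ds over the n x n box have the series 1 / (s + v z), where
   s = sqrt (1 - 4 z) and v = 1 - u; this gives the first two factorial moments
   4^(n-1) and (n-1) C(2n-2, n-1) exactly, and Wallis' bounds on C(2n, n) give
   their asymptotics.

   For the local limit, substitute z = 1 / (4 cos^2 (t/2)) on the branch cut: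
   up to an exponentially small contribution of the pole s = - v z, G_n(1 - v) is
   the mean over t of b^2 / (v^2 + b^2) * (2 + 2 cos t)^n with b = 2 sin t. The
   coefficient of u^k of the kernel is b Im (1 - i b)^(-k-1), which is
   b sin (2 k t) up to O(b^2 + k |b|^3), and the mean of
   b sin (2 k t) (2 + 2 cos t)^n is exactly
   C(2n, n+2k-1) - C(2n, n+2k+1), to be compared with a Gaussian by elementary
   means. The error terms are moments of 1 - cos t, known exactly as well.

   Partitions with max (lambda_1, lambda'_1) = n are those of the n x n box which
   are not in the (n-1) x (n-1) box, with generating polynomial G_n - G_(n-1). *)

Require Import Defs.
From mathcomp Require Import all_boot all_order all_algebra.
From mathcomp Require Import finmap.
From mathcomp Require Import all_classical all_reals all_analysis.
From mathcomp Require Import measurable_realfun.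
From mathcomp Require Import ring lra zify.

Set Implicit Arguments.
Unset Strict Implicit.
Unset Printing Implicit Defensive.

Import Order.TTheory GRing.Theory Num.Theory.
Import numFieldNormedType.Exports.

Local Open Scope classical_set_scope.
Local Open Scope ring_scope.

(** * Partitions in a box and their generating polynomials *)

Section hooks.
Local Open Scope nat_scope.

(** No contour is deformed: the coefficients of [G_n] and the cosine means are shown to obey the
    same recursion in [n]. Rationalizing [1 / (s + v z)] makes this recursion second order. For a
    fixed power of [u] its homogeneous part is [d (n+2) = 4 d (n+1) + d n], and the crude bound
    [4^n] on both sides rules out the dominant mode. The pole is therefore never isolated; it
    survives only as an error [O(2^n)].

    Even quantities in [t] that are polynomial in [cos t] have exact means, but the error [k |b|^3]
    is not of this kind. It is split by AM-GM at scale [sqrt n], which is where [k n^(-3/2)] comes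
    from.

    A binomial ratio is compared with a Gaussian only up to [O(n^(-1/2))], too coarse for a
    difference of two ratios of order [k / n]. That difference is first written exactly as a factor
    of order [k / n] times a single ratio.

    Convergence in distribution follows from the local limit: for [k <= x sqrt n] the main term
    telescopes up to [O(1/n)], and only [O(sqrt n)] terms are summed. *)

Lemma geq_trans : transitive geq.
Proof. by move=> y x z /= xy yz; exact: leq_trans yz xy. Qed.

Lemma is_part_cons x s :
  is_part (x :: s) = [&& 0 < x, part s 1 <= x & is_part s].
Proof.
rewrite /is_part /part/=; case: s => [|y s]/=; first by rewrite andbT.
by do 4 case: (_ <= _) => //=; case: path => //=; case: all.
Qed.

(* [a] and [b] are the arm and the leg of the new outermost hook; the result is
   a partition only if [part s 1 <= a] and [size s <= b]. *)
Definition add_hook (a b : nat) (s : seq nat) : seq nat :=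
  a.+1 :: [seq x.+1 | x <- s] ++ nseq (b - size s) 1.

Lemma part_add_hook a b s : part (add_hook a b s) 1 = a.+1.
Proof. by []. Qed.

Lemma size_add_hook a b s : size s <= b -> size (add_hook a b s) = b.+1.
Proof. by move=> sb; rewrite /= size_cat size_map size_nseq subnKC. Qed.

Lemma peel_add_hook a b s : is_part s -> peel (add_hook a b s) = s.
Proof.
move=> /andP[_ s0]; rewrite /peel/= map_cat -map_comp filter_cat.
rewrite (_ : [seq _ <- [seq _ | _ <- s] | _] = s).
  by rewrite map_nseq/= filter_nseq/= cats0.
elim: s s0 => //= x s ih /andP[x0 s0]; rewrite x0.
by rewrite ih.
Qed.

Lemma is_part_ones k : is_part (nseq k 1).
Proof.
elim: k => //= k ih; rewrite is_part_cons ih andbT/=.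
by case: k {ih}.
Qed.

Lemma is_part_add_hook a b s :
  is_part s -> part s 1 <= a -> is_part (add_hook a b s).
Proof.
move=> ps sa; rewrite is_part_cons /=; apply/andP; split.
  by rewrite /part; case: s sa {ps} => [|x s]//= _; case: (b - 0).
move: (b - _) => k {a b sa}; elim: s ps => [_|x s ih]; first exact: is_part_ones.
rewrite is_part_cons => /and3P[x0 sx ps] /=; rewrite is_part_cons ih//= andbT.
by case: s sx {ih ps} => [|y s]//= _; case: k.
Qed.

Lemma all_part s x : is_part s -> x \in s -> x <= part s 1.
Proof.
case: s => // y s; rewrite /is_part /part/= => /and3P[ys _ _].
rewrite inE => /predU1P[->//|xs].
by have /allP/(_ _ xs) := order_path_min geq_trans ys.
Qed.

Lemma part_le s a : is_part s -> (part s 1 <= a) = all (geq a) s.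
Proof.
move=> ps; apply/idP/allP => [sa x /(all_part ps) xs|]; first exact: leq_trans xs sa.
by case: s ps => // x s _; apply; rewrite inE eqxx.
Qed.

Lemma is_part_peel s : is_part s -> is_part (peel s).
Proof.
move=> /andP[ss s0]; apply/andP; split; last exact: filter_all.
rewrite /peel; apply: sorted_filter; first exact: geq_trans.
case: s ss {s0} => //= x s /path_sorted; rewrite sorted_map.
by apply: sub_sorted => y z /=; lia.
Qed.

Lemma part_peel s : is_part s -> part (peel s) 1 <= (part s 1).-1.
Proof.
move=> ps; rewrite part_le ?is_part_peel//; apply/allP => x.
rewrite mem_filter => /andP[_ /mapP[y ys ->]] /=.
have : y \in s by case: s ys {ps} => //= z s ys; rewrite inE ys orbT.
by move=> /(all_part ps); lia.
Qed.

Lemma size_peel s : size (peel s) <= (size s).-1.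
Proof. by rewrite (leq_trans (size_subseq (filter_subseq _ _)))// size_map size_behead. Qed.

Lemma add_hook_peel s : is_part s -> s != [::] ->
  add_hook (part s 1).-1 (size s).-1 (peel s) = s.
Proof.
case: s => // x s ps _; rewrite /add_hook/= [part _ _]/=.
move: ps; rewrite is_part_cons => /and3P[x0 _ ps]; rewrite prednK//; congr cons.
rewrite /peel/=; elim: s ps => // y s ih; rewrite is_part_cons => /and3P[y0 sy ps].
rewrite -[y :: s in RHS]/([:: y] ++ s) -[in RHS](ih ps)/=.
case: ifP => [y1|/negbT y1] /=; first by rewrite prednK// subSS.
have {}y1 : y = 1 by lia.
suff -> : [seq x <- [seq y.-1 | y <- s] | 0 < x] = [::] by rewrite !subn0 y1.
apply/eqP; rewrite -(negbK (_ == _)) -has_filter; apply/hasPn => z /mapP[w ws ->].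
by have := all_part ps ws; lia.
Qed.

(** The recursive calls are at smaller [p] and [q], but not structurally, hence the fuel [f]. The
    arm bound drops with every hook, so any [f >= p] is enough. *)
Fixpoint hook_parts (f p q : nat) : seq (seq nat) :=
  [::] :: if f is f'.+1 then
    [seq add_hook ab.1 ab.2 s | ab <- [seq (a, b) | a <- iota 0 p, b <- iota 0 q],
                                s <- hook_parts f' ab.1 ab.2]
  else [::].

Lemma mem_hook_parts f p q s : p <= f ->
  (s \in hook_parts f p q) = [&& is_part s, part s 1 <= p & size s <= q].
Proof.
elim: f p q s => [|f ih] p q s pf.
  rewrite /= inE; case: s => //= x s; rewrite is_part_cons /part /=.
  by apply/esym/negbTE; lia.
rewrite [hook_parts _ _ _]/= inE; case: eqVneq => [->//|s0 /=].
apply/allpairsPdep/idP => [[[a b] [t [/allpairsP[[a' b']/= [+ + [-> ->]]]]]]|].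
  rewrite !mem_iota => /andP[_ ap] /andP[_ bq]; rewrite ih; last lia.
  move=> /and3P[pt ta tb ->]; rewrite is_part_add_hook// size_add_hook//.
  by rewrite part_add_hook; lia.
move=> /and3P[ps sp sq].
have sz0 : 0 < size s by case: s s0 {ps sp sq}.
have p0 : 0 < part s 1 by case: s ps s0 {sp sq sz0} => // x s; rewrite is_part_cons => /andP[].
exists ((part s 1).-1, (size s).-1), (peel s); split; last by rewrite add_hook_peel.
  apply/allpairsP; exists ((part s 1).-1, (size s).-1).
  split => //; rewrite mem_iota -[X in _ <= X < _]/(_.-1);
  by move: sp sq; move: (part s 1) (size s) p0 sz0; lia.
rewrite ih /=; last lia.
by rewrite is_part_peel// part_peel// size_peel.
Qed.

Lemma uniq_hook_parts f p q : p <= f -> uniq (hook_parts f p q).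
Proof.
elim: f p q => [//|f ih] p q pf; rewrite [hook_parts _ _ _]/= cons_uniq; apply/andP; split.
  by apply/allpairsPdep => -[? [? []]].
apply: allpairs_uniq_dep.
- by apply: allpairs_uniq; rewrite ?iota_uniq // => -[? ?] [? ?] _ _ /=.
- move=> [a b] /allpairsP[[a' b']/= [+ + [-> ->]]].
  by rewrite !mem_iota => ? ?; apply: ih; lia.
move=> x y /allpairsPdep[[a b] [s [/allpairsP[[a1 b1]/= [A1 B1 [? ?]]] + ->]]].
move=> + /allpairsPdep[[a' b'] [s' [/allpairsP[[a2 b2]/= [A2 B2 [? ?]]] + ->]]]; subst.
move: A1 B1 A2 B2; rewrite !mem_iota => A1 B1 A2 B2.
rewrite !mem_hook_parts; [|lia|lia] => /and3P[ps sa sb] /and3P[ps' sa' sb'] /= ss'.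
have ea : a1 = a2 by have := part_add_hook a1 b1 s; rewrite ss' part_add_hook; lia.
have eb : b1 = b2 by have := size_add_hook a1 sb; rewrite ss' size_add_hook//; lia.
have es : s = s' by rewrite -(peel_add_hook a1 b1 ps) ss' peel_add_hook.
by subst.
Qed.

(** Parts beyond [size s] are 0, so no positive index is gained. This lets the diagonals of [s] and
    of [add_hook a b s] be compared over ranges that differ by exactly one. *)
Lemma num_hooks_widen s N : size s < N ->
  num_hooks s = \max_(d < N | d <= part s d) d.
Proof.
move=> sN; rewrite /num_hooks (big_ord_widen_cond N (fun d => d <= part s d) id)//.
apply: eq_bigl => d; case: (leqP d (part s d)) => //= ds.
rewrite ltnNge; apply/negP => sd.
by move: ds; rewrite /part nth_default; lia.
Qed.

Lemma num_hooks_add_hook a b s :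
  is_part s -> part s 1 <= a -> size s <= b ->
  num_hooks (add_hook a b s) = (num_hooks s).+1.
Proof.
move=> ps sa sb; rewrite (@num_hooks_widen s b.+1)//.
rewrite (@num_hooks_widen _ b.+2) ?size_add_hook//.
rewrite big_mkcond big_ord_recl/= ?if_same max0n -big_mkcond/=.
(* A new hook shifts the diagonal by one: old parts gain a box and move down a row, while the
   appended parts equal to 1 start at row 2 or lower and never reach the diagonal. *)
have condE (d : 'I_b.+1) : (bump 0 d <= part (add_hook a b s) (bump 0 d)) =
    (d <= part s d).
  rewrite /bump add1n /part/=; case: d => -[|d] //= _.
  rewrite nth_cat size_map; case: (ltnP d (size s)) => ds; first by rewrite (nth_map 0).
  by rewrite nth_nseq [in RHS]nth_default//; case: ifP.
under eq_bigl do rewrite condE.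
apply/eqP; rewrite eqn_leq; apply/andP; split.
  apply/bigmax_leqP => d ds; rewrite /bump add1n ltnS.
  by rewrite (bigD1 d)//= leq_maxl.
have [|d ds ->] := @eq_bigmax_cond _ [pred d : 'I_b.+1 | d <= part s d] (@nat_of_ord _).
  by apply/card_gt0P; exists ord0.
by rewrite (bigD1 d)//= leq_max /bump add1n leqnn.
Qed.

Lemma ds_add_hook a b s : is_part s -> part s 1 <= a -> size s <= b ->
  ds (add_hook a b s) = (a == b) + ds s.
Proof.
move=> ps sa sb; rewrite /ds -!sum1_card num_hooks_add_hook//.
rewrite big_mkcond big_ord_recl [in RHS]big_mkcond /=; congr addn.
  by rewrite inE /hook_row/hook_col/= size_cat size_map size_nseq subnKC// eqSS; case: eqP.
apply: eq_bigr => i _; rewrite !inE /hook_row /hook_col. rewrite lift0 !iterSr.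
by rewrite peel_add_hook.
Qed.

End hooks.

(** * Generating polynomials of [ds] and their Pascal-type recursion *)

Section hook_gf.
Variable R : comNzRingType.
Implicit Types p q : nat.

Definition hook_gf p q : {poly R} := \sum_(s <- hook_parts p p q) 'X^(ds s).

Lemma hook_gfE p q :
  hook_gf p q = 1 + \sum_(a < p) \sum_(b < q) 'X^(a == b :> nat) * hook_gf a b.
Proof.
have -> : hook_gf p q = \sum_(s <- hook_parts p.+1 p q) 'X^(ds s).
  apply: perm_big; apply: uniq_perm; rewrite ?uniq_hook_parts// => s.
  by rewrite !mem_hook_parts.
rewrite [hook_parts _ _ _]/= big_cons; congr (_ + _).
  have h0 : num_hooks [::] = 0%N by rewrite /num_hooks big_mkcond big_ord_recl big_ord0.
  by rewrite /ds h0 eq_card0 ?expr0// => -[].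
rewrite big_allpairs_dep big_allpairs.
rewrite -(big_mkord xpredT (fun a => \sum_(b < q) 'X^(a == b) * hook_gf a b)).
rewrite /index_iota subn0 big_seq [in RHS]big_seq.
apply: eq_bigr => a; rewrite mem_iota => /andP[_ ap].
rewrite -(big_mkord xpredT (fun b => 'X^(a == b) * hook_gf a b)) /index_iota subn0.
rewrite big_seq [in RHS]big_seq; apply: eq_bigr => b _ /=.
have -> : hook_gf a b = \sum_(s <- hook_parts p a b) 'X^(ds s).
  apply: perm_big; apply: uniq_perm; rewrite ?uniq_hook_parts//; [lia|] => s.
  by rewrite !mem_hook_parts//; lia.
rewrite big_distrr/= big_seq [in RHS]big_seq; apply: eq_bigr => s.
rewrite mem_hook_parts; last lia.
by move=> /and3P[? ? ?]; rewrite ds_add_hook// exprD.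
Qed.

Lemma hook_gf0n q : hook_gf 0 q = 1.
Proof. by rewrite hook_gfE big_ord0 addr0. Qed.

Lemma hook_gfn0 p : hook_gf p 0 = 1.
Proof. by rewrite hook_gfE big1 ?addr0// => a _; rewrite big_ord0. Qed.

(** The mixed second difference of the double sum in [hook_gfE] is its corner term
    ['X^(p == q) * hook_gf p q]. Moving [hook_gf p q] across leaves the factor ['X - 1] on the
    diagonal and 0 elsewhere. *)
Lemma hook_gfSS p q : hook_gf p.+1 q.+1 =
  hook_gf p q.+1 + hook_gf p.+1 q + ('X - 1) *+ (p == q) * hook_gf p q.
Proof.
have rowE n : hook_gf p.+1 n = hook_gf p n + \sum_(b < n) 'X^(p == b :> nat) * hook_gf p b.
  by rewrite hook_gfE big_ord_recr/= addrA -hook_gfE.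
rewrite rowE big_ord_recr/= (rowE q).
case: eqVneq => _; rewrite ?(expr0, expr1, mulr1n, mulr0n); ring.
Qed.

(** The number of monotone lattice paths from (m+1, m+1) to (p, q): the response of Pascal's rule to
    a unit source placed there by the diagonal point (m, m). *)
Let h p q m : nat :=
  if (m < p)%N && (m < q)%N then 'C(p - m.+1 + (q - m.+1), p - m.+1) else 0.

Let hSS p q m : h p.+1 q.+1 m = (h p q.+1 m + h p.+1 q m + ((p == q) && (m == p)))%N.
Proof.
rewrite /h !subSS !ltnS.
case: (ltngtP m p) => mp; case: (ltngtP m q) => mq //=;
  rewrite ?andbF ?(leq_trans _ mq) ?(leq_trans _ mp)//=; try lia.
- rewrite (_ : p - m = (p - m.+1).+1)%N; last lia.
  rewrite (_ : q - m = (q - m.+1).+1)%N; last lia.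
  by rewrite addSn binS addSnnS; lia.

- rewrite -mq subnn !addn0 !binn; lia.
- rewrite -mp subnn !bin0; lia.
- by rewrite -mp -mq subnn bin0 eqxx.
Qed.

(* Iterating [hook_gfSS] away from the diagonal, where it is Pascal's rule, and
   collecting the contributions of the diagonal points [(m, m)]. *)
Lemma hook_gf_sum p q M : (p <= M)%N -> hook_gf p q =
  'C(p + q, p)%:R + ('X - 1) * \sum_(m < M) hook_gf m m * (h p q m)%:R.
Proof.
elim: p q => [|p ihp] q pM.
  by rewrite hook_gf0n bin0 big1 ?mulr0 ?addr0// => m _; rewrite mulr0.
elim: q => [|q ihq].
  by rewrite hook_gfn0 addn0 binn big1 ?mulr0 ?addr0// => m _; rewrite /h andbF mulr0.
rewrite hook_gfSS ihq ihp; last lia.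
rewrite [in RHS](eq_bigr (fun m : 'I_M => hook_gf m m * (h p q.+1 m)%:R +
  hook_gf m m * (h p.+1 q m)%:R + hook_gf m m * ((p == q) && (m == p :> nat))%:R)); last first.
  by move=> m _; rewrite hSS !natrD !mulrDr.
have -> : 'C(p.+1 + q.+1, p.+1) = ('C(p.+1 + q, p.+1) + 'C(p + q.+1, p))%N.
  by rewrite addnS binS -[in RHS]addSnnS.
rewrite !big_split/= natrD.
have -> : \sum_(m < M) hook_gf m m * ((p == q) && (m == p :> nat))%:R =
    (p == q)%:R * hook_gf p q.
  rewrite (bigD1 (Ordinal pM))//= eqxx andbT big1; last first.
    move=> m; rewrite -val_eqE/= => /negbTE ->; by rewrite andbF mulr0.
  by rewrite addr0; case: eqVneq => [->|_]; rewrite ?mulr0 ?mul0r ?mulr1 ?mul1r.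
case: eqVneq => _; rewrite ?(mulr1n, mulr0n)/=; ring.
Qed.

Definition central_gf n := hook_gf n n.

Lemma central_gf0 : central_gf 0 = 1. Proof. exact: hook_gf0n. Qed.

Lemma central_gfS n : central_gf n.+1 = 'C(n.+1.*2, n.+1)%:R +
  ('X - 1) * \sum_(m < n.+1) central_gf m * 'C((n - m).*2, n - m)%:R.
Proof.
rewrite /central_gf (@hook_gf_sum _ _ n.+1)// addnn; congr (_ + _ * _).
by apply: eq_bigr => m _; rewrite /h ltn_ord subSS addnn.
Qed.

End hook_gf.

(** * Convolutions, central binomial coefficients and the second order recursion *)

Section convolution.
Variable R : comNzRingType.
Implicit Types f g : nat -> R.

Definition conv f g n := \sum_(i < n.+1) f i * g (n - i)%N.

(** Truncation to degree below [N] does not affect the coefficient [n], so commutativity and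
    associativity of [conv] are inherited from polynomials. *)
Let conv_poly f g n N : (n < N)%N ->
  conv f g n = ((\poly_(i < N) f i) * (\poly_(i < N) g i))`_n.
Proof.
move=> nN; rewrite coefM; apply: eq_bigr => i _.
have ni := ltn_ord i; rewrite !coef_poly.
have -> : (i < N)%N by lia.
by have -> : (n - i < N)%N by lia.
Qed.

Lemma eq_conv f f' g g' : f =1 f' -> g =1 g' -> conv f g =1 conv f' g'.
Proof. by move=> ff gg n; apply: eq_bigr => i _; rewrite ff gg. Qed.

Lemma convC f g : conv f g =1 conv g f.
Proof. by move=> n; rewrite !(@conv_poly _ _ _ n.+1)// mulrC. Qed.

Lemma convA f g h : conv f (conv g h) =1 conv (conv f g) h.
Proof.
move=> n; have E u v (P : {poly R}) : (forall i, (i <= n)%N -> (P`_i = conv u v i)) -> forall w,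
    conv (conv u v) w n = (P * (\poly_(i < n.+1) w i))`_n.
  move=> uvP w; rewrite coefM; apply: eq_bigr => i _.
  by rewrite coef_poly ltnS leq_subr uvP// -ltnS.
rewrite convC (E _ _ ((\poly_(i < n.+1) g i) * (\poly_(i < n.+1) h i))); last first.
  by move=> i ni; rewrite (@conv_poly _ _ _ n.+1).
rewrite (E _ _ ((\poly_(i < n.+1) f i) * (\poly_(i < n.+1) g i))); last first.
  by move=> i ni; rewrite (@conv_poly _ _ _ n.+1).
by rewrite mulrC mulrA.
Qed.

Lemma convDr f g h n : conv f (fun i => g i + h i) n = conv f g n + conv f h n.
Proof. by rewrite /conv -big_split/=; apply: eq_bigr => i _; rewrite mulrDr. Qed.

Lemma convSr f g n : conv f g n.+1 = conv f (fun i => g i.+1) n + f n.+1 * g 0%N.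
Proof.
rewrite /conv big_ord_recr/= subnn; congr (_ + _); apply: eq_bigr => i _.
by rewrite subSn// -ltnS.
Qed.

Lemma conv_mulr f g (c : R) n : conv f (fun i => c * g i) n = c * conv f g n.
Proof. by rewrite /conv mulr_sumr; apply: eq_bigr => i _; rewrite mulrCA. Qed.

End convolution.

Lemma bin_centralS n : (n.+1 * 'C(n.+1.*2, n.+1) = 2 * (n.*2.+1 * 'C(n.*2, n)))%N.
Proof.
have E1 : (n.+1 * 'C(n.*2.+2, n.+1) = n.*2.+2 * 'C(n.*2.+1, n))%N by rewrite -mul_bin_diag.
have E2 : (n.+1 * 'C(n.*2.+1, n) = n.*2.+1 * 'C(n.*2, n))%N.
  by have := mul_bin_down n.*2.+1 n; rewrite -pred_Sn => ->; congr muln; lia.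
rewrite doubleS E1 -[n.*2.+2]doubleS -mul2n -mulnA E2; lia.
Qed.

(** The weights [i] and [n - i] of mirrored terms add up to [n]. *)
Lemma conv_diag_half (b : nat -> nat) n :
  (2 * \sum_(i < n.+1) i * (b i * b (n - i)) = n * \sum_(i < n.+1) b i * b (n - i))%N.
Proof.
rewrite mul2n -addnn {2}(reindex_inj rev_ord_inj)/= -big_split big_distrr/=.
apply: eq_bigr => i _; have ni := ltn_ord i; rewrite subSS.
rewrite subKn; last by rewrite -ltnS.
move: (b i) (b (n - i)%N) => x y; rewrite (mulnC y) -mulnDl subnKC//.
Qed.

(* The sum [c n] satisfies [n.+1 * c n.+1 = 4 * n.+1 * c n]: symmetrize, then use
   [bin_centralS]. *)
Lemma conv_bin_central n :
  (\sum_(i < n.+1) 'C(i.*2, i) * 'C((n - i).*2, n - i) = 4 ^ n)%N.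
Proof.
have [b bE] : exists b : nat -> nat, forall i, 'C(i.*2, i) = b i by eexists.
have bS i : (i.+1 * b i.+1 = 2 * (i.*2.+1 * b i))%N by rewrite -!bE bin_centralS.
under eq_bigr do rewrite !bE.
elim: n => [|n ih]; first by rewrite big_ord_recr big_ord0 -bE.
apply/eqP; rewrite -(eqn_pmul2l (ltn0Sn n)) -conv_diag_half big_ord_recl mul0n add0n/=.
under eq_bigr => i _ do rewrite /bump add1n subSS mulnA bS.
have -> : (\sum_(i < n.+1) 2 * (i.*2.+1 * b i) * b (n - i) =
  2 * (2 * \sum_(i < n.+1) i * (b i * b (n - i))) + 2 * \sum_(i < n.+1) b i * b (n - i))%N.
  rewrite !big_distrr -big_split/=; apply: eq_bigr => i _.
  move: (b i) (b (n - i)%N) => x y; rewrite -mul2n -addn1; ring.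
by rewrite conv_diag_half ih expnS; apply/eqP; ring.
Qed.

Section central_recursion.
Variable R : comNzRingType.
Let a n : {poly R} := 'C(n.*2, n)%:R.

(* With s = sqrt (1 - 4 z) and v = 1 - u, [central_gfS] says that the series of
   [central_gf] is 1 / (s + v z) = (s - v z) / (1 - 4 z - v^2 z^2). *)
Lemma central_gfSS n : central_gf R n.+2 = 4 * central_gf R n.+1 +
  ('X - 1) ^+ 2 * central_gf R n + ('C(n.+2.*2, n.+2)%:R - 4 * 'C(n.+1.*2, n.+1)%:R).
Proof.
(* The series of [a] is [(1 - 4 z)^(-1/2)], so convolving twice with it gives the geometric [F]. The
   recursion of [T] then has order one, which yields [Q n.+1 - 4 Q n = ('X - 1) G n]. *)
pose G := central_gf R; pose Q := conv a G; pose F := fun i : nat => 4 ^+ i : {poly R}.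
pose T := conv F G.
have aa : conv a a =1 F.
  move=> i; rewrite /conv /F -natrX -conv_bin_central natr_sum.
  by apply: eq_bigr => j _; rewrite natrM.
have GS i : G i.+1 = a i.+1 + ('X - 1) * Q i by rewrite /G central_gfS /Q convC.
have Q0 : Q 0%N = 1 by rewrite /Q /conv big_ord1 /a /G central_gf0 mulr1.
have T0 : T 0%N = 1 by rewrite /T /conv big_ord1 /F /G central_gf0 mulr1.
have QS i : Q i.+1 = F i.+1 + ('X - 1) * T i.
  rewrite /Q convSr (@eq_conv _ a a _ (fun i => a i.+1 + ('X - 1) * Q i))//.
  rewrite convDr conv_mulr addrAC /T -(eq_conv aa (frefl G)) -convA; congr (_ + _).
  by rewrite -aa convSr /G central_gf0 /a.
have TS i : T i.+1 = 4 * T i + G i.+1.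
  rewrite /T convC convSr (@eq_conv _ G G _ (fun i => 4 * F i))//.
    by rewrite conv_mulr convC /F expr0 mulr1.
  by move=> j; rewrite /F exprS.
rewrite -!/(G _) (GS n.+1) (GS n) -!/(a _).
have -> : Q n.+1 = 4 * Q n + ('X - 1) * G n; last by ring.
case: n => [|n]; first by rewrite QS Q0 T0 /F /G central_gf0 expr1; ring.
by rewrite (QS n.+1) TS (QS n) /F exprS; ring.
Qed.

Lemma central_gf1 : central_gf R 1 = 1 + 'X.
Proof.
rewrite central_gfS big_ord1 central_gf0 mul1r subnn bin0 bin1.
by rewrite (_ : 1.*2 = 2)%N//; ring.
Qed.

End central_recursion.

(** * Cosine means and Wallis' bounds *)

Section cosine_mean.
Context {R : realType}.
Implicit Types f g F : R -> R.
Notation mu := (@lebesgue_measure R).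

Definition mean f : R := pi^-1 * (\int[mu]_(t in `[0%R, pi]) f t)%R.

Lemma integrable_mean f : continuous f -> mu.-integrable `[0%R, pi] (EFin \o f).
Proof.
move=> cf; apply: continuous_compact_integrable; first exact: segment_compact.
exact: continuous_subspaceT.
Qed.

Lemma meanD f g : continuous f -> continuous g ->
  mean (fun t => f t + g t) = mean f + mean g.
Proof.
by move=> cf cg; rewrite /mean RintegralD//; [exact: mulrDr|exact: integrable_mean..].
Qed.

Lemma meanZ f (c : R) : continuous f -> mean (fun t => c * f t) = c * mean f.
Proof.
by move=> cf; rewrite /mean RintegralZl//; [exact: mulrCA|exact: integrable_mean].
Qed.

Lemma eq_mean f g : f =1 g -> mean f = mean g.
Proof. by move=> fg; rewrite /mean; congr (_ * _); apply: eq_Rintegral => x _. Qed.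

Lemma meanB f g : continuous f -> continuous g ->
  mean (fun t => f t - g t) = mean f - mean g.
Proof.
by move=> cf cg; rewrite /mean RintegralB//; [exact: mulrBr|exact: integrable_mean..].
Qed.

Lemma le_mean f g : continuous f -> continuous g ->
  (forall t, 0 <= t <= pi -> f t <= g t) -> mean f <= mean g.
Proof.
move=> cf cg fg; rewrite /mean ler_wpM2l// ?invr_ge0 ?pi_ge0//.
by apply: le_Rintegral => //; [exact: integrable_mean|exact: integrable_mean].
Qed.

Lemma mean_is_derive F f : continuous f -> (forall t : R, is_derive t 1 F (f t)) ->
  mean f = (F pi - F 0) / pi.
Proof.
move=> cf dF; rewrite mulrC /mean /Rintegral; congr (_ * _).
have cF : continuous F.
  by move=> t; apply/differentiable_continuous/derivable1_diffP; case: (dF t).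
rewrite (@continuous_FTC2 _ f F)//; first exact: pi_gt0.
- exact: continuous_subspaceT.
- split; first by move=> t _; case: (dF t).
  + exact/cvg_at_right_filter/cF.
  + exact/cvg_at_left_filter/cF.
- by move=> t _; rewrite derive1E; case: (dF t).
Qed.

Lemma ct_cst (c : R) : continuous (fun _ : R => c).
Proof. by move=> t; exact: cvg_cst. Qed.

Lemma ctD f g : continuous f -> continuous g -> continuous (fun t => f t + g t).
Proof. by move=> cf cg t; apply: cvgD; [exact: cf|exact: cg]. Qed.

Lemma ctN f : continuous f -> continuous (fun t => - f t).
Proof. by move=> cf t; apply: cvgN; exact: cf. Qed.

Lemma ctM f g : continuous f -> continuous g -> continuous (fun t => f t * g t).
Proof. by move=> cf cg t; apply: cvgM; [exact: cf|exact: cg]. Qed.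

Lemma ctX f n : continuous f -> continuous (fun t => f t ^+ n).
Proof.
move=> cf; elim: n => [|n ih]; first exact: ct_cst.
have -> : (fun t => f t ^+ n.+1) = (fun t => f t * f t ^+ n).
  by apply/funext => t; rewrite exprS.
exact: ctM.
Qed.

Lemma ctV f : (forall t, f t != 0) -> continuous f -> continuous (fun t => (f t)^-1).
Proof. by move=> f0 cf t; apply: cvgV; [exact: f0|exact: cf]. Qed.

Lemma ct_id : continuous (fun t : R => t).
Proof. by move=> t; exact: cvg_id. Qed.

Lemma ct_cos f : continuous f -> continuous (fun t => cos (f t)).
Proof. by move=> cf t; apply: continuous_comp; [exact: cf|exact: continuous_cos]. Qed.

Lemma ct_sin f : continuous f -> continuous (fun t => sin (f t)).
Proof. by move=> cf t; apply: continuous_comp; [exact: cf|exact: continuous_sin]. Qed.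

End cosine_mean.

Ltac cont := first [assumption | match goal with |- continuous ?F => lazymatch F with
  | fun t => GRing.add (@?f t) (@?g t) => refine (@ctD _ f g _ _); cont
  | fun t => GRing.opp (@?f t) => refine (@ctN _ f _); cont
  | fun t => GRing.mul (@?f t) (@?g t) => refine (@ctM _ f g _ _); cont
  | fun t => GRing.exp (@?f t) ?n => refine (@ctX _ f n _); cont
  | fun t => cos (@?f t) => refine (@ct_cos _ f _); cont
  | fun t => sin (@?f t) => refine (@ct_sin _ f _); cont
  | fun t => t => exact: ct_id
  | fun t => ?c => exact: ct_cst
  end end].

Section binomial_mean.
Context {R : realType}.

Lemma is_derive_linear (c t : R) : is_derive t 1 (fun u => c * u) c.
Proof.
have -> : (fun u => c * u) = c \*: (@id R) by apply/funext.
by apply: is_derive_eq; rewrite /GRing.scale/= mulr1.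
Qed.

Lemma mean1 : mean (fun _ : R => 1) = 1.
Proof.
rewrite (@mean_is_derive _ id)//; last exact: ct_cst.
by rewrite subr0 divff// gt_eqF// pi_gt0.
Qed.

Lemma sin_natpi m : sin (m%:R * pi) = 0 :> R.
Proof.
elim: m => [|m ih]; first by rewrite mul0r sin0.
by rewrite -addn1 natrD mulrDl mul1r sinD ih sinpi mul0r mulr0 addr0.
Qed.

Lemma mean_cos m : mean (fun t : R => cos (m%:R * t)) = (m == 0)%:R.
Proof.
case: m => [|m].
  by rewrite -[RHS]mean1; apply: eq_mean => t; rewrite mul0r cos0.
have dF (t : R) : is_derive t 1 (fun t => m.+1%:R^-1 * sin (m.+1%:R * t)) (cos (m.+1%:R * t)).
  have d := is_derive1_comp (is_derive_sin _) (is_derive_linear m.+1%:R t).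
  have := is_deriveZ m.+1%:R^-1 d.
  move=> /is_derive_eq; apply; rewrite /GRing.scale/=.
  by rewrite mulrCA mulVf ?mulr1// pnatr_eq0.
have cc : continuous (fun t : R => cos (m.+1%:R * t)) by cont.
by rewrite (mean_is_derive cc dF) sin_natpi !mulr0 sin0 mulr0 subrr mul0r.
Qed.

(** These are the Fourier coefficients of [(2 + 2 cos t)^n], which equals
    [exp (- i n t) (1 + exp (i t))^(2 n)]. In real terms, multiplying by [2 + 2 cos t] is Pascal's
    rule applied twice; [m = 0] also uses the symmetry of binomials. *)
Lemma mean_cos_pow n m :
  mean (fun t : R => cos (m%:R * t) * (2 + 2 * cos t) ^+ n) = 'C(n.*2, n + m)%:R.
Proof.
elim: n m => [|n ih] m.
  rewrite add0n bin0n -mean_cos; apply: eq_mean => t; by rewrite expr0 mulr1.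
have c k : continuous (fun t : R => cos (k%:R * t) * (2 + 2 * cos t) ^+ n) by cont.
case: m => [|m].
  rewrite (@eq_mean _ _ (fun t => 2 * (cos (0%:R * t) * (2 + 2 * cos t) ^+ n) +
    2 * (cos (1%:R * t) * (2 + 2 * cos t) ^+ n))); last first.
    by move=> t; rewrite exprS mul1r mul0r cos0; ring.
  rewrite meanD ?meanZ ?ih; [|by cont..].
  rewrite !addn0 addn1; case: n {ih c} => [|n].
    by rewrite (_ : 0.*2 = 0)%N// (_ : 1.*2 = 2)%N// !(bin0, bin1)/=; ring.
  rewrite [n.+2.*2]doubleS !binS.
  have -> : 'C(n.+1.*2, n) = 'C(n.+1.*2, n.+2).
    by rewrite -bin_sub; [congr 'C(_, _); lia|lia].
  by rewrite !natrD; ring.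
rewrite (@eq_mean _ _ (fun t => 2 * (cos (m.+1%:R * t) * (2 + 2 * cos t) ^+ n) +
  (cos (m.+2%:R * t) * (2 + 2 * cos t) ^+ n + cos (m%:R * t) * (2 + 2 * cos t) ^+ n))); last first.
  move=> t; rewrite exprS.
  have -> : cos (m.+2%:R * t) = cos (m.+1%:R * t + t) by congr cos; rewrite -natr1; ring.
  have -> : cos (m%:R * t) = cos (m.+1%:R * t - t) by congr cos; rewrite -natr1; ring.
  rewrite cosD cosB; ring.
rewrite meanD ?meanD ?meanZ ?ih; [|by cont..].
rewrite doubleS addSn !binS !addnS !natrD; ring.
Qed.

Lemma mean_pow n : mean (fun t : R => (2 + 2 * cos t) ^+ n) = 'C(n.*2, n)%:R.
Proof.
have := mean_cos_pow n 0; rewrite addn0 => <-; apply: eq_mean => t.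
by rewrite mul0r cos0 mul1r.
Qed.

Lemma mean_Zpow (c : R) n :
  mean (fun t : R => c * (2 + 2 * cos t) ^+ n) = c * 'C(n.*2, n)%:R.
Proof. by rewrite meanZ ?mean_pow//; cont. Qed.

Lemma bin_centralSr n : (n%:R + 1) * 'C(n.+1.*2, n.+1)%:R =
  2 * (2 * n%:R + 1) * 'C(n.*2, n)%:R :> R.
Proof.
rewrite natr1 -natrM bin_centralS -[n.*2.+1]addn1 -mul2n 2!natrM natrD natrM; ring.
Qed.

(** Expressing [1 - cos t] as [2 - x / 2] with [x = 2 + 2 cos t] reduces this to central binomials.
    Relative to [mean_pow], it and the next moment are of order [1 / n] and [1 / n^2], which sets
    the size of the errors in the local limit. *)
Lemma mean_1Mcos_pow n : mean (fun t : R => (1 - cos t) * (2 + 2 * cos t) ^+ n) =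
  'C(n.*2, n)%:R / (n%:R + 1).
Proof.
rewrite (@eq_mean _ _ (fun t => 2 * (2 + 2 * cos t) ^+ n -
    2^-1 * (2 + 2 * cos t) ^+ n.+1)); last first.
  by move=> t; rewrite exprS; field.
rewrite meanB ?mean_Zpow; [|by cont..].
have n1 : n%:R + 1 != 0 :> R by rewrite natr1 pnatr_eq0.
apply: (mulfI n1); rewrite mulrBr [X in _ - X]mulrCA bin_centralSr.
by field.
Qed.

Lemma mean_1Mcos2_pow n : mean (fun t : R => (1 - cos t) ^+ 2 * (2 + 2 * cos t) ^+ n) =
  3 * 'C(n.*2, n)%:R / ((n%:R + 1) * (n%:R + 2)).
Proof.
rewrite (@eq_mean _ _ (fun t => 4 * (2 + 2 * cos t) ^+ n +
  (- 2 * (2 + 2 * cos t) ^+ n.+1 + 4^-1 * (2 + 2 * cos t) ^+ n.+2))); last first.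
  by move=> t; rewrite !exprS; field.
have cp (c : R) k : continuous (fun t : R => c * (2 + 2 * cos t) ^+ k) by cont.
rewrite (meanD (cp 4 n) (ctD (cp _ n.+1) (cp _ n.+2))) (meanD (cp _ n.+1) (cp _ n.+2)).
rewrite !mean_Zpow.
have n1 : n%:R + 1 != 0 :> R by rewrite natr1 pnatr_eq0.
have n2 : n%:R + 2 != 0 :> R by rewrite -natrD pnatr_eq0 addn2.
have E1 := bin_centralSr n; have := bin_centralSr n.+1.
rewrite -natr1 -addrA (_ : 1 + 1 = 2)// => E2.
move: E1 E2; move: ('C(n.*2, n)%:R) ('C(n.+1.*2, n.+1)%:R) ('C(n.+2.*2, n.+2)%:R) => x y z.
move=> E1 E2; have -> : y = 2 * (2 * n%:R + 1) * x / (n%:R + 1) by rewrite -E1; field.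
have -> : z = 2 * (2 * (n%:R + 1) + 1) * (2 * (2 * n%:R + 1) * x / (n%:R + 1)) / (n%:R + 2).
  by rewrite -E1 [_ * y]mulrC mulfK// -E2; field.
by field; rewrite n1 n2.
Qed.

End binomial_mean.

(** * Wallis' integrals and the size of central binomial coefficients *)

Section wallis.
Context {R : realType}.

Let W m : R := mean (fun t => cos (2^-1 * t) ^+ m).

Let cW m : continuous (fun t : R => cos (2^-1 * t) ^+ m).
Proof. by cont. Qed.

Let W0 : W 0 = 1. Proof. by rewrite -[RHS]mean1. Qed.

Let dsin (t : R) : is_derive t 1 (fun t => sin (2^-1 * t)) (2^-1 * cos (2^-1 * t)).
Proof.
have /is_derive_eq := is_derive1_comp (is_derive_sin _) (is_derive_linear 2^-1 t).
by apply; rewrite mulrC.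
Qed.

Let dcos (t : R) : is_derive t 1 (fun t => cos (2^-1 * t)) (2^-1 * - sin (2^-1 * t)).
Proof.
have /is_derive_eq := is_derive1_comp (is_derive_cos _) (is_derive_linear 2^-1 t).
by apply; rewrite mulrC.
Qed.

Let W1 : W 1 = 2 / pi.
Proof.
have dF (t : R) : is_derive t 1 (fun t => 2 * sin (2^-1 * t)) (cos (2^-1 * t) ^+ 1).
  have := is_deriveZ 2 (dsin t); move=> /is_derive_eq; apply.
  by rewrite /GRing.scale/= expr1; field.
rewrite /W (mean_is_derive (@cW 1%N) dF).
by rewrite mulr0 sin0 (mulrC _ pi) sin_pihalf; ring.
Qed.

(** Integration by parts through the explicit antiderivative [2 sin (t/2) cos (t/2)^(m+1)], which
    vanishes at both 0 and [pi]. *)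
Let WSS m : (m%:R + 2) * W m.+2 = (m%:R + 1) * W m.
Proof.
have cZ (c : R) k : continuous (fun t : R => c * cos (2^-1 * t) ^+ k) by cont.
apply/eqP; rewrite -subr_eq0 /W -(meanZ _ (@cW m)) -(meanZ _ (@cW m.+2)).
rewrite -(meanB (cZ _ _) (cZ _ _)).
have dF (t : R) : is_derive t 1 (fun t => 2 * (sin (2^-1 * t) * cos (2^-1 * t) ^+ m.+1))
    ((m%:R + 2) * cos (2^-1 * t) ^+ m.+2 - (m%:R + 1) * cos (2^-1 * t) ^+ m).
  have := is_deriveZ 2 (is_deriveM (dsin t) (is_deriveX m.+1 (dcos t))).
  rewrite (_ : (_ \*: _) = (fun t => 2 * (sin (2^-1 * t) * cos (2^-1 * t) ^+ m.+1))); last first.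
    by apply/funext => u; rewrite /= !fctE.
  move=> /is_derive_eq; apply; rewrite /GRing.scale/= !fctE.
  rewrite -natr1 !exprS; move: (cos2Dsin2 (2^-1 * t)); move: (cos _) (sin _) (_ ^+ m) => c s p.
  move=> cs; apply/eqP; rewrite -subr_eq0; apply/eqP.
  transitivity ((m%:R + 1) * p * (1 - (c ^+ 2 + s ^+ 2))); last by rewrite cs; ring.
  by field.
rewrite (mean_is_derive _ dF); last first.
  by apply: ctD; [exact: cZ|apply: ctN; exact: cZ].
by rewrite mulr0 sin0 (mulrC _ pi) cos_pihalf exprS; apply/eqP; ring.
Qed.

Let cos01 (t : R) : 0 <= t <= pi -> 0 <= cos (2^-1 * t) <= 1.
Proof. by move=> /andP[t0 tpi]; rewrite cos_le1 cos_ge0_pihalf//; lra. Qed.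

Let W_ge0 m : 0 <= W m.
Proof.
apply: (@le_trans _ _ (mean (fun=> 0 : R))).
  by rewrite /mean /Rintegral integral0 mulr0.
apply: le_mean; [exact: ct_cst|exact: cW|] => t /cos01/andP[? _].
exact: exprn_ge0.
Qed.

Let W_nincr m : W m.+1 <= W m.
Proof.
apply: le_mean; [exact: cW|exact: cW|] => t /cos01/andP[c0 c1].
by rewrite exprS ler_piMl// exprn_ge0.
Qed.

Let W_prod m : m.+1%:R * (W m * W m.+1) = 2 / pi.
Proof.
elim: m => [|m ih]; first by rewrite W0 W1; ring.
rewrite -ih -!natr1 -addrA (_ : 1 + 1 = 2)// mulrCA WSS; ring.
Qed.

Let W_even n : W n.*2 * 4 ^+ n = 'C(n.*2, n)%:R.
Proof.
elim: n => [|n ih]; first by rewrite W0 expr0 mulr1 bin0.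
have n1 : n%:R + 1 != 0 :> R by rewrite natr1 pnatr_eq0.
apply: (mulfI n1); rewrite bin_centralSr -ih.
have := WSS n.*2; rewrite -[n.*2.+2]doubleS -[in n.*2%:R]mul2n natrM exprS.
move: (W n.+1.*2) (W n.*2) (4 ^+ n) => x y p E.
transitivity (2 * p * ((2 * n%:R + 2) * x)); first by ring.
by rewrite E; ring.
Qed.

Lemma bin_central_gt0 n : 0 < 'C(n.*2, n)%:R :> R.
Proof. by rewrite ltr0n bin_gt0; lia. Qed.

(** By monotonicity [W (2n)^2] lies between [W (2n) W (2n+1)] and [W (2n-1) W (2n)], and products of
    neighbours are known exactly from [W_prod]. *)
Lemma wallis_bounds n : (0 < n)%N ->
  @pi R * n%:R <= (4 ^+ n / 'C(n.*2, n)%:R) ^+ 2 <= @pi R * (n%:R + 2^-1).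
Proof.
move=> n0; rewrite -W_even.
have W0n k : 0 < W k.
  rewrite lt_neqAle W_ge0 andbT; apply/eqP => W0k.
  have := W_prod k; rewrite -W0k mul0r mulr0 => /eqP.
  by rewrite lt_eqF// divr_gt0// pi_gt0.
have p4 : 4 ^+ n != 0 :> R by rewrite expf_neq0.
rewrite invfM mulrCA divff// mulr1 exprVn.
have pi0 := @pi_gt0 R; have W2 k : 0 < W k ^+ 2 by rewrite exprn_gt0.
have WW k : 0 < W k * W k.+1 by apply: mulr_gt0.
have EW k : (W k * W k.+1)^-1 = pi * (k.+1%:R / 2).
  have k0 : k.+1%:R != 0 :> R by rewrite pnatr_eq0.
  have -> : W k * W k.+1 = 2 / pi / k.+1%:R.
    by apply: (mulfI k0); rewrite W_prod [RHS]mulrC divfK.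
  move: k.+1%:R pi k0 (lt0r_neq0 pi0) => x y x0 y0; by field; rewrite x0 y0.
apply/andP; split.
- case: n n0 {p4} => // n _.
  rewrite (_ : n.+1%:R = n.*2.+2%:R / 2 :> R); last by rewrite -doubleS -muln2 natrM mulfK.
  by rewrite -EW lef_pV2 ?posrE ?W2 ?WW// expr2 doubleS ler_wpM2r// W_ge0.
- rewrite (_ : n%:R + 2^-1 = n.*2.+1%:R / 2); last first.
    by rewrite -[n.*2.+1]addn1 natrD -[n.*2]muln2 natrM; field.
  by rewrite -EW lef_pV2 ?posrE ?W2 ?WW// expr2 ler_wpM2l// W_ge0.
Qed.

End wallis.

(** * Integral representation of the counts *)

Section dominated_recursion.
Context {R : realType}.

Lemma le0_geometric (z C x : R) : 0 <= z < 1 -> 0 < C ->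
  (forall m, x <= C * z ^+ m) -> x <= 0.
Proof.
move=> /andP[z0 z1] C0 xz; rewrite leNgt; apply/negP => x0.
have nz1 : `|z| < 1 by rewrite ger0_norm.
have [//|N _ NP] := (cvgr0Pnorm_lt _).1 (cvg_expr nz1) (x / C); first by rewrite divr_gt0.
have := NP N (leqnn _); rewrite /= ger0_norm ?exprn_ge0// ltr_pdivlMr// => h.
by have := xz N; rewrite mulrC leNgt h.
Qed.

(* The characteristic roots are 2 + sqrt 5 > 4 and 2 - sqrt 5; the growth bound
   excludes the first one. *)
Lemma recursion_le_pow2 (d f : nat -> R) :
  (forall n, d n.+2 = 4 * d n.+1 + d n + f n) ->
  (forall n, `|d n| <= 2 * 4 ^+ n) -> (forall n, `|f n| <= 27 * 2 ^+ n) ->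
  forall n, `|d n| <= 9 * 2 ^+ n.
Proof.
move=> dE d4 f2; pose s : R := Num.sqrt 5.
have s2 : s ^+ 2 = 5 by rewrite sqr_sqrtr.
have s0 : 0 <= s by rewrite sqrtr_ge0.
have sl : 22 / 10 <= s by rewrite -(@ler_pXn2r _ 2)// ?nnegrE// s2; lra.
have su : s <= 224 / 100 by rewrite -(@ler_pXn2r _ 2)// ?nnegrE// s2; lra.
(* Removing the small root leaves a first order recursion with the single factor [2 + s]. *)
pose e n := d n.+1 - (2 - s) * d n.
have eS n : e n.+1 = (2 + s) * e n + f n.
  rewrite /e dE; apply/eqP; rewrite -subr_eq0; apply/eqP.
  transitivity ((5 - s ^+ 2) * d n); last by rewrite s2; ring.
  by ring.
have e2 n : `|e n| <= 13 * 2 ^+ n.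
  rewrite -subr_le0.
  (* An excess of [|e n|] over [13 * 2 ^+ n] would be multiplied by at least [2 + s > 4] at each
     step, the source being absorbed because [27 <= 13 * s]. This contradicts the bound by a
     multiple of [4 ^+ n]. *)
  have grow m : (2 + s) ^+ m * (`|e n| - 13 * 2 ^+ n) <= `|e (n + m)%N| - 13 * 2 ^+ (n + m).
    elim: m => [|m ih]; first by rewrite mul1r addn0.
    rewrite addnS eS exprS -mulrA.
    apply: (@le_trans _ _ ((2 + s) * (`|e (n + m)%N| - 13 * 2 ^+ (n + m)))).
      by rewrite ler_wpM2l//; lra.
    have := lerB_normD ((2 + s) * e (n + m)%N) (f (n + m)%N).
    have -> : `|(2 + s) * e (n + m)%N| = (2 + s) * `|e (n + m)%N|.
      by rewrite normrM ger0_norm//; lra.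
    have := f2 (n + m)%N; rewrite exprS.
    have : 0 <= 2 ^+ (n + m) :> R by rewrite exprn_ge0.
    move: (2 ^+ (n + m)) `|f _| `|e (n + m)%N| `|_ + _| => p F E G p0; nra.
  have q0 : 0 < 4 ^+ n :> R by rewrite exprn_gt0.
  apply: (@le0_geometric (4 / (2 + s)) (9 * 4 ^+ n)).
  - by apply/andP; split; [rewrite divr_ge0//|rewrite ltr_pdivrMr]; lra.
  - lra.
  move=> m; rewrite expr_div_n mulrA ler_pdivlMr; last by rewrite exprn_gt0//; lra.
  rewrite mulrC (le_trans (grow m))//.
  have : 0 <= 2 ^+ (n + m) :> R by rewrite exprn_ge0.
  have := ler_normB (d (n + m).+1) ((2 - s) * d (n + m)%N).
  have -> : `|(2 - s) * d (n + m)%N| = (s - 2) * `|d (n + m)%N|.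
    by rewrite normrM ltr0_norm ?opprB//; lra.
  have := d4 (n + m).+1; have := d4 (n + m)%N.
  rewrite -mulrA -exprD exprS -/(e _); have : 0 <= 4 ^+ (n + m) :> R by rewrite exprn_ge0.
  move: (4 ^+ _) `|e _| `|d _.+1| `|d _| (2 ^+ _) (normr_ge0 (d (n + m)%N)) => p E D1 D0 q D00; nra.
(* The induction closes because [13 + 9 * (s - 2) <= 18]. *)
elim=> [|n ih]; first by have := d4 0%N; rewrite !expr0; lra.
have -> : d n.+1 = e n + (2 - s) * d n by rewrite /e; ring.
have := ler_normD (e n) ((2 - s) * d n).
have -> : `|(2 - s) * d n| = (s - 2) * `|d n|.
  by rewrite normrM ltr0_norm ?opprB//; lra.
have := e2 n; rewrite exprS; have : 0 <= 2 ^+ n :> R by rewrite exprn_ge0.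
move: ih; move: (2 ^+ n) `|d n| `|e n| `|_ + _| (normr_ge0 (d n)) => p D E G D0; nra.
Qed.

End dominated_recursion.

(** * Powers of [(1 - i b)^-1] in real coordinates *)

Section resolvent.
Context {R : realType}.
Implicit Types (b t : R) (k n : nat).

(* Real and imaginary parts of (1 - i b)^-k. *)
Fixpoint resolv b k : R * R := if k is k'.+1 then
    let z := resolv b k' in
    ((z.1 - b * z.2) / (1 + b ^+ 2), (z.2 + b * z.1) / (1 + b ^+ 2))
  else (1, 0).

Let den_gt0 b : 0 < 1 + b ^+ 2.
Proof. by rewrite ltr_wpDr// sqr_ge0. Qed.

Let den_neq0 b : 1 + b ^+ 2 != 0.
Proof. by rewrite gt_eqF. Qed.

Lemma resolv_norm b k : (resolv b k).1 ^+ 2 + (resolv b k).2 ^+ 2 <= 1.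
Proof.
elim: k => [|k ih]; first by rewrite /= expr1n expr0n addr0.
rewrite /=; move: (resolv b k) ih => [x y] /= ih.
have -> : ((x - b * y) / (1 + b ^+ 2)) ^+ 2 + ((y + b * x) / (1 + b ^+ 2)) ^+ 2 =
    (x ^+ 2 + y ^+ 2) / (1 + b ^+ 2) by field.
by rewrite ler_pdivrMr// mul1r (le_trans ih)// lerDl sqr_ge0.
Qed.

(** [(1 - i b)^-1] and its conjugate are the roots of [(1 + b^2) z^2 - 2 z + 1]. *)
Lemma resolvSS b k : (1 + b ^+ 2) * (resolv b k.+2).2 =
  2 * (resolv b k.+1).2 - (resolv b k).2.
Proof. by rewrite /=; move: (resolv b k) => [x y] /=; field. Qed.

(** One factor [(1 - i b)^-1], of modulus [(1 + b^2)^(-1/2)], compensates [b]; the other [k] factors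
    have modulus at most 1. The bound being uniform in [k], the kernel means are at most [4^n]. *)
Lemma resolv_im_le1 b k : `|b * (resolv b k.+1).2| <= 1.
Proof.
rewrite -(@ler_pXn2r _ 2)// ?nnegrE// expr1n -normrX ger0_norm ?sqr_ge0//.
have := resolv_norm b k; rewrite /=; move: (resolv b k) => [x y] /= xy.
rewrite mulrA expr_div_n ler_pdivrMr ?exprn_gt0// mul1r.
have := sqr_ge0 (b * y - x); have := sqr_ge0 b => b0 h.
have : (y + b * x) ^+ 2 <= (1 + b ^+ 2) * (x ^+ 2 + y ^+ 2).
  by rewrite -subr_ge0 (le_trans h)// le_eqVlt; apply/orP; left; apply/eqP; ring.
have : (1 + b ^+ 2) * (x ^+ 2 + y ^+ 2) <= 1 + b ^+ 2.
  by rewrite ler_piMr// ltW.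
rewrite exprMn; have := sqr_ge0 (y + b * x).
move: (b ^+ 2) (_ ^+ 2) b0 => B Y B0; nra.
Qed.

(** The triangle inequality of the plane in squared form. It rests on Cauchy-Schwarz, whose defect
    is [(x v - y u)^2]. *)
Lemma pair_norm_triangle (x y u v A B : R) : 0 <= A -> 0 <= B ->
  x ^+ 2 + y ^+ 2 <= A ^+ 2 -> u ^+ 2 + v ^+ 2 <= B ^+ 2 ->
  (x + u) ^+ 2 + (y + v) ^+ 2 <= (A + B) ^+ 2.
Proof.
move=> A0 B0 xA uB.
suff : x * u + y * v <= A * B by nra.
apply: le_trans (ler_norm _) _.
rewrite -(@ler_pXn2r _ 2)// ?nnegrE ?mulr_ge0// -normrX ger0_norm ?sqr_ge0//.
rewrite exprMn; apply: (@le_trans _ _ ((x ^+ 2 + y ^+ 2) * (u ^+ 2 + v ^+ 2))).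
  have := sqr_ge0 (x * v - y * u); lra.
by apply: ler_pM => //; rewrite addr_ge0// sqr_ge0.
Qed.

(* (1 - i b)^-1 agrees with exp (2 i t) up to O(t^2) when b = 2 sin t. *)
Lemma resolv_cis t k :
  ((resolv (2 * sin t) k.+1).1 - cos (2 * k%:R * t)) ^+ 2 +
  ((resolv (2 * sin t) k.+1).2 - sin (2 * k%:R * t)) ^+ 2 <=
  (`|2 * sin t| + 14 * k%:R * (1 - cos t)) ^+ 2.
Proof.
have y0 : 0 <= 1 - cos t by rewrite subr_ge0 cos_le1.
elim: k => [|k].
  rewrite mulr0 mul0r cos0 sin0 mulr0 mul0r addr0 /= !(mulr0, mulr1, subr0, add0r).
  set b := 2 * sin t; rewrite -normrX ger0_norm ?sqr_ge0//.
  have -> : (1 / (1 + b ^+ 2) - 1) ^+ 2 + (b / (1 + b ^+ 2)) ^+ 2 =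
    b ^+ 2 / (1 + b ^+ 2) by field.
  by rewrite ler_pdivrMr// ler_peMr ?sqr_ge0// lerDl sqr_ge0.
set b := 2 * sin t.
have -> : resolv b k.+2 = (((resolv b k.+1).1 - b * (resolv b k.+1).2) / (1 + b ^+ 2),
  ((resolv b k.+1).2 + b * (resolv b k.+1).1) / (1 + b ^+ 2)) by [].
move: (resolv b k.+1) => [x y] /=; set p := cos (2 * k%:R * t); set q := sin (2 * k%:R * t).
move=> ih.
have -> : 2 * k.+1%:R * t = 2 * k%:R * t + (t + t) by rewrite -natr1; ring.
rewrite (cosD (_ * t)) (sinD (_ * t)) cosD sinD -/p -/q.
have pq : p ^+ 2 + q ^+ 2 = 1 by rewrite cos2Dsin2.
have cs := cos2Dsin2 t; move: (cos_le1 t) (cos_geN1 t) y0 ih cs.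
move: @b; move: (cos t) (sin t) => c s b c1 cN1 y0 ih cs.
have b2 : b ^+ 2 = 4 * s ^+ 2 by rewrite /b; ring.
pose D := 1 + b ^+ 2; have D0 : D != 0 by exact: den_neq0.
(* Put [z = (1 - i b)^-1] and [w = exp (2 i t)]. The step uses [z^(k+2) - w^(k+1) = z (z^(k+1) -
   w^k) + w^k (z - w)]. Here [ur + i ui] is [1 - (1 - i b) w], and [(vr + i vi) / D] is [z - w]. *)
pose ur := 1 - (c ^+ 2 - s ^+ 2) - b * (2 * s * c).
pose ui := b * (c ^+ 2 - s ^+ 2) - 2 * s * c.
pose vr := ur - b * ui; pose vi := ui + b * ur.
rewrite -/D.
have -> : (x - b * y) / D - (p * (c * c - s * s) - q * (s * c + c * s)) =
  ((x - p) - b * (y - q)) / D + (p * vr - q * vi) / D.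
  rewrite /vr /vi /ur /ui -mulrDl; apply: (mulIf D0); rewrite mulrBl !divfK// /D; ring.
have -> : (y + b * x) / D - (q * (c * c - s * s) + p * (s * c + c * s)) =
  ((y - q) + b * (x - p)) / D + (q * vr + p * vi) / D.
  rewrite /vr /vi /ur /ui -mulrDl; apply: (mulIf D0); rewrite mulrBl !divfK// /D; ring.
have -> : `|b| + 14 * k.+1%:R * (1 - c) = (`|b| + 14 * k%:R * (1 - c)) + 14 * (1 - c).
  by rewrite -natr1; ring.
have D1 : 1 <= D by rewrite lerDl sqr_ge0.
apply: pair_norm_triangle.
- by rewrite addr_ge0// mulr_ge0// mulr_ge0.
- by rewrite mulr_ge0.
- apply: le_trans ih.
  have -> : ((x - p - b * (y - q)) / D) ^+ 2 + ((y - q + b * (x - p)) / D) ^+ 2 =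
    ((x - p) ^+ 2 + (y - q) ^+ 2) / D by rewrite /D; field.
  by rewrite ler_pdivrMr ?(lt_le_trans _ D1)// ler_peMr// addr_ge0// sqr_ge0.
- have -> : ((p * vr - q * vi) / D) ^+ 2 + ((q * vr + p * vi) / D) ^+ 2 =
    (ur ^+ 2 + ui ^+ 2) / D.
    transitivity ((p ^+ 2 + q ^+ 2) * (ur ^+ 2 + ui ^+ 2) / D); last by rewrite pq mul1r.
    by rewrite /vr /vi; clearbody ur ui p q; rewrite /D; field.
  apply: (@le_trans _ _ (ur ^+ 2 + ui ^+ 2)).
    by rewrite ler_pdivrMr ?(lt_le_trans _ D1)// ler_peMr// addr_ge0// sqr_ge0.
  have s2 : s ^+ 2 = (1 - c) * (1 + c) by rewrite -[X in _ = X]addr0; lra.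
  have -> : ur = (1 - c) * (2 * (1 + c) * (1 - 2 * c)).
    transitivity (1 - c ^+ 2 + s ^+ 2 - 4 * c * s ^+ 2); first by rewrite /ur /b; ring.
    by rewrite s2; ring.
  have -> : ui ^+ 2 = (1 - c) ^+ 2 * (4 * s ^+ 2 * (1 + 2 * c) ^+ 2).
    have -> : ui = 2 * s * (c ^+ 2 - s ^+ 2 - c) by rewrite /ui /b; ring.
    have -> : c ^+ 2 - s ^+ 2 - c = (c - 1) * (1 + 2 * c) by rewrite s2; ring.
    by ring.
  rewrite [(_ * _) ^+ 2]exprMn [X in _ <= X]exprMn [X in _ <= X]mulrC -mulrDr ler_wpM2l ?sqr_ge0//.
  rewrite s2.
  (* The constant 14 of the statement comes from [12^2 + 4 * 3^2 = 180 <= 14^2]. *)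
  have h1 : (2 * (1 + c) * (1 - 2 * c)) ^+ 2 <= 12 ^+ 2.
    by rewrite -ler_sqrt ?sqrtr_sqr// ?exprn_ge0// (@ger0_norm _ 12)// ler_norml; nra.
  have h2 : 4 * ((1 - c) * (1 + c)) * (1 + 2 * c) ^+ 2 <= 4 * 1 * 3 ^+ 2.
    apply: ler_pM; rewrite ?sqr_ge0//; [nra|nra|].
    by rewrite -ler_sqrt ?sqrtr_sqr// ?exprn_ge0// (@ger0_norm _ 3)// ler_norml; nra.
  lra.
Qed.

Lemma resolv_im_sin t k :
  `|2 * sin t * (resolv (2 * sin t) k.+1).2 - 2 * sin t * sin (2 * k%:R * t)| <=
  8 * (1 - cos t) + 14 * k%:R * (`|2 * sin t| * (1 - cos t)).
Proof.
have y0 : 0 <= 1 - cos t by rewrite subr_ge0 cos_le1.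
set b := 2 * sin t; rewrite -mulrBr normrM.
have b8 : `|b| ^+ 2 <= 8 * (1 - cos t).
  rewrite -normrX ger0_norm ?sqr_ge0// /b.
  by have := cos2Dsin2 t; have := cos_geN1 t; move: y0; move: (cos t) (sin t) => c s; nra.
have k0 : 0 <= 14 * k%:R :> R by rewrite mulr_ge0.
have h : `|(resolv b k.+1).2 - sin (2 * k%:R * t)| <= `|b| + 14 * k%:R * (1 - cos t).
  rewrite -(@ler_pXn2r _ 2)// ?nnegrE// ?addr_ge0 ?mulr_ge0// -normrX ger0_norm ?sqr_ge0//.
  by apply: le_trans (resolv_cis t k); rewrite lerDr sqr_ge0.
apply: le_trans (ler_wpM2l (normr_ge0 b) h) _.
by rewrite mulrDr -expr2 lerD// mulrCA.
Qed.

End resolvent.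

Section central_counts.
Context {R : realType}.
Implicit Types k n : nat.

Definition ds_count n k : R := (central_gf R n)`_k.

Lemma hook_gf1E p q : (hook_gf R p q).[1] = 'C(p + q, p)%:R.
Proof.
rewrite (@hook_gf_sum _ p q p)// hornerD hornerM hornerD hornerX hornerN hornerC subrr mul0r addr0.
by rewrite -[X in X.[_]]/(_%:R) -polyC_natr hornerC.
Qed.

Lemma central_gf1E n : (central_gf R n).[1] = 'C(n.*2, n)%:R.
Proof. by rewrite hook_gf1E addnn. Qed.

Lemma ds_count_ge0 n k : 0 <= ds_count n k.
Proof. by rewrite /ds_count coef_sum sumr_ge0// => s _; rewrite coefXn. Qed.

Lemma ds_count_le n k : ds_count n k <= 'C(n.*2, n)%:R.
Proof.
rewrite -central_gf1E /ds_count coef_sum horner_sum ler_sum// => s _.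
by rewrite coefXn hornerXn expr1n; case: eqP.
Qed.

Lemma bin_central_le n : 'C(n.*2, n)%:R <= 4 ^+ n :> R.
Proof.
rewrite -(natrX _ 4) ler_nat -[(4 ^ n)%N]conv_bin_central big_ord_recl/=.
by rewrite subn0 bin0 mul1n leq_addr.
Qed.

Lemma ds_countSS n k : ds_count n.+2 k = 4 * ds_count n.+1 k + ds_count n k
  - (if k is k'.+1 then 2 * ds_count n k' else 0)
  + (if k is k'.+2 then ds_count n k' else 0)
  + (if k is 0 then 'C(n.+2.*2, n.+2)%:R - 4 * 'C(n.+1.*2, n.+1)%:R else 0).
Proof.
have E : central_gf R n.+2 = 4%:P * central_gf R n.+1 + central_gf R n -
    2%:P * (central_gf R n * 'X) + central_gf R n * 'X * 'X +
    ('C(n.+2.*2, n.+2)%:R - 4 * 'C(n.+1.*2, n.+1)%:R)%:P.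
  by rewrite central_gfSS polyCB polyCM !polyC_natr -!polyC_natr; ring.
rewrite /ds_count E !(coefD, coefN, coefCM, coefMX, coefC).
by case: k => [|[|k]]//=; ring.
Qed.

Let b (t : R) := 2 * sin t.
Let x (t : R) := 2 + 2 * cos t.

Let b2 t : b t ^+ 2 = 4 * x t - x t ^+ 2.
Proof. by rewrite /b /x exprMn sin2cos2; ring. Qed.

(* The coefficient of u^k in b^2 / ((1 - u)^2 + b^2), where b = 2 sin t. *)
Definition kern k (t : R) := b t * (resolv (b t) k.+1).2.

Let ct_resolv k : continuous (fun t => (resolv (b t) k).1) /\
  continuous (fun t => (resolv (b t) k).2).
Proof.
have cb : continuous b by rewrite /b; cont.
have cd : continuous (fun t => (1 + b t ^+ 2)^-1).
  apply: ctV; first by move=> t; rewrite gt_eqF// ltr_wpDr// sqr_ge0.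
  by cont.
by elim: k => [|k [c1 c2]]; split => /=; cont.
Qed.

Lemma ct_kern k : continuous (kern k).
Proof.
have [_ c2] := ct_resolv k.+1.
have cb : continuous b by rewrite /b; cont.
by rewrite /kern; cont.
Qed.

Definition kern_mean n k := mean (fun t : R => kern k t * (2 + 2 * cos t) ^+ n).

Let cx n : continuous (fun t => x t ^+ n).
Proof. by rewrite /x; cont. Qed.

Let ckx n k : continuous (fun t => kern k t * x t ^+ n).
Proof. by apply: ctM; [exact: ct_kern|exact: cx]. Qed.

(** This is the recursion of [ds_countSS]. With [x = 2 + 2 cos t] one has [x^2 = 4 x - b^2], and
    [resolvSS] expresses [(1 + b^2) kern k] by lower kernels. At [k = 0] it leaves [b^2], whose
    contribution [x^(n+2) - 4 x^(n+1)] has the inhomogeneous term as its mean. *)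
Lemma kern_meanSS n k : kern_mean n.+2 k = 4 * kern_mean n.+1 k + kern_mean n k
  - (if k is k'.+1 then 2 * kern_mean n k' else 0)
  + (if k is k'.+2 then kern_mean n k' else 0)
  + (if k is 0 then 'C(n.+2.*2, n.+2)%:R - 4 * 'C(n.+1.*2, n.+1)%:R else 0).
Proof.
have kb t : (1 + b t ^+ 2) * kern k t = (if k is k'.+1 then 2 * kern k' t else 0)
  - (if k is k'.+2 then kern k' t else 0) + (if k is 0 then b t ^+ 2 else 0).
  rewrite /kern mulrCA; case: k => [|[|k]].
  - by rewrite /=; field; rewrite gt_eqF// ltr_wpDr// sqr_ge0.
  - by rewrite resolvSS/=; ring.
  - by rewrite resolvSS; ring.
have step t : kern k t * x t ^+ n.+2 = 4 * (kern k t * x t ^+ n.+1) + kern k t * x t ^+ n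
    - (1 + b t ^+ 2) * kern k t * x t ^+ n.
  by rewrite b2 !exprS; ring.
have lin4 (c1 c2 c3 c4 : R) (f1 f2 f3 f4 : R -> R) : continuous f1 -> continuous f2 ->
    continuous f3 -> continuous f4 ->
    mean (fun t : R => c1 * f1 t + c2 * f2 t + c3 * f3 t + c4 * f4 t) =
    c1 * mean f1 + c2 * mean f2 + c3 * mean f3 + c4 * mean f4.
  move=> k1 k2 k3 k4.
  have z (c : R) (f : R -> R) : continuous f -> continuous (fun t : R => c * f t).
    by move=> cf; apply: ctM => //; exact: ct_cst.
  have [z1 z2 z3 z4] := And4 (z c1 f1 k1) (z c2 f2 k2) (z c3 f3 k3) (z c4 f4 k4).
  rewrite (meanD (ctD (ctD z1 z2) z3) z4) (meanD (ctD z1 z2) z3) (meanD z1 z2).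
  by rewrite !meanZ.
rewrite /kern_mean -!mean_pow; case: k kb step => [|[|k]] kb step.
- rewrite (@eq_mean _ _ (fun t => 4 * (kern 0 t * x t ^+ n.+1) + 1 * (kern 0 t * x t ^+ n)
    + (- 4) * (x t ^+ n.+1) + 1 * x t ^+ n.+2)); last first.
    by move=> t; rewrite step kb b2 !exprS; ring.
  rewrite lin4; [|exact: ckx|exact: ckx|exact: cx|exact: cx].
  by rewrite /x; ring.
- rewrite (@eq_mean _ _ (fun t => 4 * (kern 1 t * x t ^+ n.+1) + 1 * (kern 1 t * x t ^+ n)
    + (- 2) * (kern 0 t * x t ^+ n) + 0 * (kern 0 t * x t ^+ n))); last first.
    by move=> t; rewrite step kb; ring.
  rewrite lin4; [|exact: ckx..].
  by rewrite /x; ring.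
- rewrite (@eq_mean _ _ (fun t => 4 * (kern k.+2 t * x t ^+ n.+1) + 1 * (kern k.+2 t * x t ^+ n)
    + (- 2) * (kern k.+1 t * x t ^+ n) + 1 * (kern k t * x t ^+ n))); last first.
    by move=> t; rewrite step kb; ring.
  rewrite lin4; [|exact: ckx..].
  by rewrite /x; ring.
Qed.

Let x_ge0 t : 0 <= x t.
Proof. by rewrite /x; have := cos_geN1 t; lra. Qed.

Lemma normr_mean_le (f g : R -> R) : continuous f -> continuous g ->
  (forall t, `|f t| <= g t) -> `|mean f| <= mean g.
Proof.
move=> cf cg fg; rewrite ler_norml; apply/andP; split.
  rewrite -mulN1r -meanZ//; apply: le_mean => //.
    by apply: ctM => //; exact: ct_cst.
  by move=> t _; rewrite mulN1r; have := fg t; rewrite ler_norml => /andP[].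
by apply: le_mean => // t _; apply: le_trans (ler_norm _) (fg t).
Qed.

Lemma kern_mean_le n k : `|kern_mean n k| <= 4 ^+ n.
Proof.
apply: (@le_trans _ _ (mean (fun t => x t ^+ n))); last by rewrite mean_pow bin_central_le.
apply: normr_mean_le; [exact: ckx|exact: cx|] => t.
rewrite normrM (ger0_norm (exprn_ge0 _ (x_ge0 t))) ler_piMl ?exprn_ge0//.
exact: resolv_im_le1.
Qed.

(* Both sides satisfy the same recursion in [n], up to a solution which cannot
   grow like its dominant mode since both are at most 4^n. *)
Lemma ds_count_kern_mean n k : `|ds_count n k - kern_mean n k| <= 9 * 2 ^+ n.
Proof.
pose d k n := ds_count n k - kern_mean n k.
have d4 j m : `|d j m| <= 2 * 4 ^+ m.
  rewrite (le_trans (ler_normB _ _))// mulr_natl mulr2n lerD ?kern_mean_le//.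
  by rewrite ger0_norm ?ds_count_ge0// (le_trans (ds_count_le _ _))// bin_central_le.
rewrite -/(d k n).
pose f k n := (if k is k'.+2 then d k' n else 0) - (if k is k'.+1 then 2 * d k' n else 0).
have dSS j m : d j m.+2 = 4 * d j m.+1 + d j m + f j m.
  rewrite /d /f ds_countSS kern_meanSS; case: j => [|[|j]]; rewrite /d; ring.
(* The source for [k] involves [k - 1] and [k - 2], so two consecutive indices are carried along;
   [27 = 9 + 2 * 9] bounds it. *)
suff H : forall j, (forall m, `|d j m| <= 9 * 2 ^+ m) /\ (forall m, `|d j.+1 m| <= 9 * 2 ^+ m).
  by have [] := H k.
have dec j : (forall m, `|f j m| <= 27 * 2 ^+ m) -> forall m, `|d j m| <= 9 * 2 ^+ m.
  by move=> fj m; exact: (recursion_le_pow2 (dSS j) (d4 j) fj).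
have p0 m : 0 <= 2 ^+ m :> R by rewrite exprn_ge0.
elim=> [|j [ih1 ih2]].
  have d0 m : `|d 0%N m| <= 9 * 2 ^+ m.
    by apply: dec => i; rewrite /f subr0 normr0 mulr_ge0.
  split=> //; apply: dec => m; rewrite /f sub0r normrN normrM ger0_norm//.
  by have := d0 m; have := p0 m; lra.
split=> //; apply: dec => m; rewrite /f (le_trans (ler_normB _ _))// normrM (@ger0_norm _ 2)//.
by have := ih1 m; have := ih2 m; have := p0 m; lra.
Qed.

(** The error of [resolv_im_sin] contains [|sin t| (1 - cos t)], which has no exact mean here. AM-GM
    trades it for [(1 - cos t) / r] and [r (1 - cos t)^2], and [r] is left free to balance the
    two. *)
Lemma kern_mean_sin n k (r : R) : 0 < r ->
  `|kern_mean n k - mean (fun t => 2 * sin t * sin (2 * k%:R * t) * (2 + 2 * cos t) ^+ n)|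
  <= 'C(n.*2, n)%:R * ((8 + 56 * k%:R / r) / (n%:R + 1) +
                       21 * k%:R * r / ((n%:R + 1) * (n%:R + 2))).
Proof.
move=> r0; have cs : continuous (fun t : R => 2 * sin t * sin (2 * k%:R * t) * x t ^+ n).
  by rewrite /x; cont.
rewrite /kern_mean -(meanB (@ckx n k) cs).
pose c1 := 8 + 56 * k%:R / r; pose c2 := 7 * k%:R * r.
have cy m : continuous (fun t => (1 - cos t) ^+ m * x t ^+ n) by rewrite /x; cont.
have cz c m : continuous (fun t => c * ((1 - cos t) ^+ m * x t ^+ n)).
  by apply: ctM; [exact: ct_cst|exact: cy].
apply: (@le_trans _ _ (mean (fun t => c1 * ((1 - cos t) ^+ 1 * x t ^+ n) +
    c2 * ((1 - cos t) ^+ 2 * x t ^+ n)))); last first.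
  rewrite (meanD (cz _ _) (cz _ _)) !meanZ; [|exact: cy..].
  rewrite /x mean_1Mcos2_pow mean_1Mcos_pow /c1 /c2 le_eqVlt; apply/orP; left.
  have n1 : n%:R + 1 != 0 :> R by rewrite natr1 pnatr_eq0.
  have n2 : n%:R + 2 != 0 :> R by rewrite -natrD pnatr_eq0 addn2.
  by apply/eqP; field; rewrite n1 n2 gt_eqF.
apply: normr_mean_le.
- by apply: ctD; [exact: ckx|apply: ctN; exact: cs].
- by apply: ctD; exact: cz.
move=> t; rewrite -mulrBl normrM (ger0_norm (exprn_ge0 _ (x_ge0 t))) !mulrA -mulrDl.
rewrite ler_wpM2r ?exprn_ge0// /kern /b (le_trans (resolv_im_sin t k))//.
have y0 : 0 <= 1 - cos t by rewrite subr_ge0 cos_le1.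
have b8 : `|2 * sin t| ^+ 2 <= 8 * (1 - cos t).
  rewrite -normrX ger0_norm ?sqr_ge0//.
  by have := cos2Dsin2 t; have := cos_geN1 t; move: y0; move: (cos t) (sin t) => c s; nra.
have am : `|2 * sin t| * (1 - cos t) <= 4 * (1 - cos t) / r + r * (1 - cos t) ^+ 2 / 2.
  move: b8; move: `|_| (1 - cos t) => B y b8.
  rewrite -subr_ge0 (_ : _ - _ = (r * y - B) ^+ 2 / (2 * r) + (8 * y - B ^+ 2) / (2 * r)).
    by rewrite addr_ge0// divr_ge0 ?sqr_ge0 ?subr_ge0// ltW// mulr_gt0.
  by field; rewrite gt_eqF.
have k0 : 0 <= k%:R :> R := ler0n _ _.
have {am} := ler_wpM2l (_ : 0 <= 14 * k%:R) am.
rewrite mulr_ge0// => /(_ isT) am.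
by rewrite /c1 /c2 expr1; lra.
Qed.

Lemma mean_sin_sin_pow n k : mean (fun t : R =>
    2 * sin t * sin (2 * k.+1%:R * t) * (2 + 2 * cos t) ^+ n) =
  'C(n.*2, n + k.*2.+1)%:R - 'C(n.*2, n + k.*2.+3)%:R.
Proof.
rewrite -!mean_cos_pow -meanB; [|by cont..].
apply: eq_mean => t; rewrite -mulrBl; congr (_ * _).
have -> : k.*2.+1%:R * t = 2 * k.+1%:R * t - t.
  by rewrite -[k.*2.+1]addn1 -mul2n natrD natrM -natr1; ring.
have -> : k.*2.+3%:R * t = 2 * k.+1%:R * t + t.
  by rewrite -[k.*2.+3]addn3 -mul2n natrD natrM -natr1; ring.
rewrite cosB cosD; ring.
Qed.

End central_counts.

(** * Local limit theorem *)

Section binomial_ratio.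
Context {R : realType}.
Implicit Types (n j k : nat) (x y : R).

Lemma mulr_expRN_le1 x : x * expR (- x) <= 1.
Proof.
rewrite expRN ler_pdivrMr ?expR_gt0// mul1r (le_trans _ (expR_ge1Dx x))//.
by rewrite lerDr.
Qed.

Lemma mulr2_expRN_le4 x : 0 <= x -> x ^+ 2 * expR (- x) <= 4.
Proof.
move=> x0; have -> : x ^+ 2 * expR (- x) = 4 * (x / 2 * expR (- (x / 2))) ^+ 2.
  have -> : - x = - (x / 2) + - (x / 2) by field.
  by rewrite expRD; field.
have h := mulr_expRN_le1 (x / 2).
have h0 : 0 <= x / 2 * expR (- (x / 2)) by rewrite mulr_ge0 ?expR_ge0 ?divr_ge0.
by rewrite -[X in _ <= X]mulr1 ler_wpM2l// expr_le1.
Qed.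

Lemma expRN_sub_le x y : x <= y -> expR (- x) - expR (- y) <= expR (- x) * (y - x).
Proof.
move=> xy; have -> : - y = - x + - (y - x) by ring.
rewrite expRD -[X in X - _]mulr1 -mulrBr ler_wpM2l ?expR_ge0//.
by have := expR_ge1Dx (- (y - x)); lra.
Qed.

Definition bin_ratio n j : R := 'C(n.*2, n + j)%:R / 'C(n.*2, n)%:R.

Let a0 n : 'C(n.*2, n)%:R != 0 :> R.
Proof. by rewrite gt_eqF// bin_central_gt0. Qed.

Lemma bin_ratio_ge0 n j : 0 <= bin_ratio n j.
Proof. by rewrite divr_ge0. Qed.

Lemma bin_ratio0 n : bin_ratio n 0 = 1.
Proof. by rewrite /bin_ratio addn0 divff. Qed.

Lemma bin_ratioS n j : (j <= n)%N ->
  (n%:R + j%:R + 1) * bin_ratio n j.+1 = (n%:R - j%:R) * bin_ratio n j.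
Proof.
move=> jn; rewrite /bin_ratio !mulrA; congr (_ / _).
rewrite -natrD natr1 -natrB// -!natrM; congr (_%:R).
rewrite addnS mul_bin_left; congr muln; lia.
Qed.

(** Each successive ratio is [1 - (2 i + 1) / (n + i + 1)], at most [exp (- (2 i + 1) / (n + j))],
    and the odd numbers add up to [i^2]. The separate bound [j] keeps the denominator fixed during
    the induction. *)
Lemma bin_ratio_le n j i : (i <= j)%N -> (j <= n)%N ->
  bin_ratio n i <= expR (- (i%:R ^+ 2 / (n%:R + j%:R))).
Proof.
move=> + jn; elim: i => [|i ih] ij; first by rewrite bin_ratio0 expr0n/= mul0r oppr0 expR0.
have i0 : 0 <= i%:R :> R := ler0n _ _.
have iR : i%:R + 1 <= j%:R :> R by rewrite natr1 ler_nat.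
have nR : j%:R <= n%:R :> R by rewrite ler_nat.
have d0 : 0 < n%:R + i%:R + 1 :> R by lra.
have nj0 : 0 < n%:R + j%:R :> R by lra.
have -> : bin_ratio n i.+1 = (n%:R - i%:R) / (n%:R + i%:R + 1) * bin_ratio n i.
  apply: (mulfI (lt0r_neq0 d0)); rewrite bin_ratioS; last lia.
  by rewrite [RHS]mulrA; congr (_ * _); rewrite [RHS]mulrC divfK// gt_eqF.
have -> : - (i.+1%:R ^+ 2 / (n%:R + j%:R)) =
    - ((2 * i%:R + 1) / (n%:R + j%:R)) + - (i%:R ^+ 2 / (n%:R + j%:R)) :> R.
  by rewrite -natr1; field; rewrite gt_eqF.
rewrite expRD; apply: ler_pM; [by apply: divr_ge0; lra|exact: bin_ratio_ge0| |by apply: ih; lia].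
apply: le_trans (expR_ge1Dx _); rewrite -subr_ge0.
have -> : 1 - (2 * i%:R + 1) / (n%:R + j%:R) - (n%:R - i%:R) / (n%:R + i%:R + 1) =
  (2 * i%:R + 1) * (j%:R - i%:R - 1) / ((n%:R + j%:R) * (n%:R + i%:R + 1)) :> R.
  by field; rewrite !gt_eqF.
by rewrite divr_ge0 ?mulr_ge0//; lra.
Qed.

(** Dual to [bin_ratio_le]: the inverse ratio is [1 + (2 i + 1) / (n - i)], and [n - i >= n - j + 1]
    when [i < j]. *)
Lemma bin_ratio_ge n j i : (i <= j)%N -> (j <= n)%N ->
  expR (- (i%:R ^+ 2 / (n%:R - j%:R + 1))) <= bin_ratio n i.
Proof.
move=> + jn; elim: i => [|i ih] ij; first by rewrite bin_ratio0 expr0n/= mul0r oppr0 expR0.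
have i0 : 0 <= i%:R :> R := ler0n _ _.
have iR : i%:R + 1 <= j%:R :> R by rewrite natr1 ler_nat.
have nR : j%:R <= n%:R :> R by rewrite ler_nat.
have d0 : 0 < n%:R + i%:R + 1 :> R by lra.
have ni0 : 0 < n%:R - i%:R :> R by lra.
have nj0 : 0 < n%:R - j%:R + 1 :> R by lra.
have -> : bin_ratio n i.+1 = (n%:R - i%:R) / (n%:R + i%:R + 1) * bin_ratio n i.
  apply: (mulfI (lt0r_neq0 d0)); rewrite bin_ratioS; last lia.
  by rewrite [RHS]mulrA; congr (_ * _); rewrite [RHS]mulrC divfK// gt_eqF.
have -> : - (i.+1%:R ^+ 2 / (n%:R - j%:R + 1)) =
    - ((2 * i%:R + 1) / (n%:R - j%:R + 1)) + - (i%:R ^+ 2 / (n%:R - j%:R + 1)) :> R.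
  by rewrite -natr1; field; rewrite gt_eqF.
rewrite expRD; apply: ler_pM; [exact: expR_ge0|exact: expR_ge0| |by apply: ih; lia].
rewrite expRN -[leRHS]invrK lef_pV2 ?posrE ?expR_gt0 ?invr_gt0 ?divr_gt0//.
apply: le_trans (expR_ge1Dx _); rewrite invf_div -subr_ge0.
have -> : 1 + (2 * i%:R + 1) / (n%:R - j%:R + 1) - (n%:R + i%:R + 1) / (n%:R - i%:R) =
  (2 * i%:R + 1) * (j%:R - i%:R - 1) / ((n%:R - j%:R + 1) * (n%:R - i%:R)) :> R.
  by field; rewrite !gt_eqF.
by rewrite divr_ge0 ?mulr_ge0//; lra.
Qed.

Lemma bin_ratio_le1 n j : (j <= n)%N -> bin_ratio n j <= 1.
Proof.
move=> jn; apply: le_trans (bin_ratio_le (leqnn j) jn) _.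
by rewrite -[leRHS]expR0 ler_expR oppr_le0 divr_ge0 ?exprn_ge0// addr_ge0.
Qed.

Lemma sqr_bin_ratio n j : (j <= n)%N -> j%:R ^+ 2 * bin_ratio n j <= 2 * n%:R.
Proof.
case: n => [|n] jn.
  by move: jn; rewrite leqn0 => /eqP->; rewrite expr0n/= mul0r mulr0.
have j0 : 0 <= j%:R :> R := ler0n _ _.
have nR : j%:R <= n.+1%:R :> R by rewrite ler_nat.
have n0 : 0 < n.+1%:R :> R by rewrite ltr0n.
apply: le_trans (_ : n.+1%:R + j%:R <= _); last lra.
apply: le_trans (ler_wpM2l _ (bin_ratio_le (leqnn j) jn)) _; first by rewrite exprn_ge0.
have := mulr_expRN_le1 (j%:R ^+ 2 / (n.+1%:R + j%:R)).
by rewrite mulrAC ler_pdivrMr ?mul1r//; lra.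
Qed.

(* j^3 is split by AM-GM as (s j^2 + j^4 / s) / 2. *)
Let cube_expRN (j s N : R) : 0 <= j -> 0 < s -> 0 < N ->
  j ^+ 3 * expR (- (j ^+ 2 / N)) <= (N * s + 4 * N ^+ 2 / s) / 2.
Proof.
move=> j0 s0 N0; set e := expR _; have e0 : 0 <= e by exact: expR_ge0.
have h1 : j ^+ 2 * e <= N.
  by have := mulr_expRN_le1 (j ^+ 2 / N); rewrite mulrAC ler_pdivrMr// mul1r.
have h2 : j ^+ 4 * e <= 4 * N ^+ 2.
  have := mulr2_expRN_le4 (divr_ge0 (exprn_ge0 2 j0) (ltW N0)).
  by rewrite expr_div_n mulrAC ler_pdivrMr ?exprn_gt0// -exprM.
have h3 : j ^+ 3 <= (j ^+ 2 * s + j ^+ 4 / s) / 2.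
  rewrite -subr_ge0 (_ : _ - _ = j ^+ 2 * (s - j) ^+ 2 / (2 * s)).
    by apply: divr_ge0; apply: mulr_ge0; rewrite ?sqr_ge0 ?ltW.
  by field; rewrite gt_eqF.
apply: le_trans (ler_wpM2r e0 h3) _.
have -> : (j ^+ 2 * s + j ^+ 4 / s) / 2 * e = ((j ^+ 2 * e) * s + (j ^+ 4 * e) / s) / 2.
  by field; rewrite gt_eqF.
rewrite ler_wpM2r ?invr_ge0// lerD// ?ler_wpM2r// ?invr_ge0 ltW//.
Qed.

(** Replacing [n + j] or [n - j + 1] by [n] in the exponent changes it by [O(j^3 / n^2)]. Against
    the Gaussian factor [j^3] is worth only [n^(3/2)]. The condition on [j] keeps [n - j + 1] above
    [n / 2]. *)
Lemma bin_ratio_gauss n j : (0 < n)%N -> (j.*2 <= n)%N ->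
  `|bin_ratio n j - expR (- (j%:R ^+ 2 / n%:R))| <= 5 / Num.sqrt n%:R.
Proof.
move=> n0 jn; set s := Num.sqrt _.
have nR : 0 < n%:R :> R by rewrite ltr0n.
have s0 : 0 < s by rewrite sqrtr_gt0.
have s2 : s ^+ 2 = n%:R by rewrite sqr_sqrtr// ltW.
have j0 : 0 <= j%:R :> R := ler0n _ _.
have jR : 2 * j%:R <= n%:R :> R by rewrite -natrM ler_nat mul2n.
have jn' : (j <= n)%N by lia.
set J := j%:R in j0 jR *; set N := n%:R in nR s2 jR *.
have N0 : N != 0 by rewrite gt_eqF.
rewrite ler_norml; apply/andP; split.
- case: j jn' @J jn j0 jR => [|j] jn' J jn j0 jR.
    by rewrite bin_ratio0 /J expr0n/= mul0r oppr0 expR0 subrr oppr_le0 divr_ge0// ltW.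
  have J1 : 1 <= J by rewrite /J -natr1 lerDr.
  rewrite lerBrDr addrC -lerBrDr opprK.
  have lo := bin_ratio_ge (leqnn _) jn'; rewrite -/J -/N in lo.
  rewrite -lerBlDl.
  apply: le_trans (_ : expR (- (J ^+ 2 / N)) - expR (- (J ^+ 2 / (N - J + 1))) <= _).
    by rewrite lerD2l lerN2.
  have Q0 : 0 < N - J + 1 by lra.
  apply: le_trans (expRN_sub_le _) _.
    by rewrite ler_wpM2l ?exprn_ge0// lef_pV2 ?posrE//; lra.
  have -> : J ^+ 2 / (N - J + 1) - J ^+ 2 / N = J ^+ 2 * (J - 1) / (N * (N - J + 1)).
    by clearbody N J; field; rewrite N0 gt_eqF.
  apply: (@le_trans _ _ (J ^+ 3 * expR (- (J ^+ 2 / N)) / (N * (N - J + 1)))).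
    rewrite [leLHS]mulrA; apply: ler_wpM2r; first by rewrite invr_ge0 mulr_ge0// ltW.
    rewrite [leLHS]mulrC; apply: ler_wpM2r; first exact: expR_ge0.
    by rewrite [J ^+ 3]exprSr; apply: ler_wpM2l; [exact: exprn_ge0|lra].
  rewrite ler_pdivrMr ?mulr_gt0//.
  apply: le_trans (cube_expRN j0 s0 nR) _.
  rewrite -s2 in N0 nR jR Q0 *; rewrite -(ler_pM2r s0).
  have -> : (s ^+ 2 * s + 4 * (s ^+ 2) ^+ 2 / s) / 2 * s = 5 / 2 * s ^+ 2 * s ^+ 2.
    by field; rewrite gt_eqF.
  have -> : 5 / s * (s ^+ 2 * (s ^+ 2 - J + 1)) * s = 5 * s ^+ 2 * (s ^+ 2 - J + 1).
    by field; rewrite gt_eqF.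
  by have := ltW nR; nra.
- have up := bin_ratio_le (leqnn _) jn'; rewrite -/J -/N in up.
  apply: le_trans (_ : expR (- (J ^+ 2 / (N + J))) - expR (- (J ^+ 2 / N)) <= _).
    by rewrite lerD2r.
  have Q0 : 0 < N + J by lra.
  apply: le_trans (expRN_sub_le _) _.
    by rewrite ler_wpM2l ?exprn_ge0// lef_pV2 ?posrE//; lra.
  have -> : expR (- (J ^+ 2 / (N + J))) * (J ^+ 2 / N - J ^+ 2 / (N + J)) =
      J ^+ 3 * expR (- (J ^+ 2 / (N + J))) / (N * (N + J)).
    by clearbody N J; field; rewrite N0 gt_eqF.
  rewrite ler_pdivrMr ?mulr_gt0//.
  apply: le_trans (cube_expRN j0 s0 Q0) _.
  rewrite -s2 in N0 nR jR Q0 *; rewrite -(ler_pM2r s0).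
  have -> : ((s ^+ 2 + J) * s + 4 * (s ^+ 2 + J) ^+ 2 / s) / 2 * s =
      (s ^+ 2 + J) * (s ^+ 2 / 2 + 2 * (s ^+ 2 + J)).
    by field; rewrite gt_eqF.
  have -> : 5 / s * (s ^+ 2 * (s ^+ 2 + J)) * s = (s ^+ 2 + J) * (5 * s ^+ 2).
    by field; rewrite gt_eqF.
  by rewrite ler_wpM2l ?ltW//; lra.
Qed.

End binomial_ratio.

Section local_limit.
Context {R : realType}.
Implicit Types (n j k : nat).

Definition llt_main n k : R := 8 * k%:R / n%:R * expR (- 4 * k%:R ^+ 2 / n%:R).

Definition llt_err n k : R := k%:R / (n%:R * Num.sqrt n%:R) + n%:R^-1.

Lemma bin_ratio_diff n j : (0 < j)%N -> (j <= n)%N ->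
  bin_ratio n j.-1 - bin_ratio n j.+1 =
  2 * j%:R * (2 * n%:R + 1) / ((n%:R + 1) ^+ 2 - j%:R ^+ 2) * bin_ratio n j :> R.
Proof.
case: j => // j _ jn /=.
have jR : j%:R + 1 <= n%:R :> R by rewrite natr1 ler_nat.
have j0 : 0 <= j%:R :> R := ler0n _ _.
have nj0 : n%:R - j%:R != 0 :> R by rewrite gt_eqF; lra.
have nj1 : n%:R + j%:R + 2 != 0 :> R by rewrite gt_eqF; lra.
have E1 := @bin_ratioS R n j (ltnW jn); have E2 := @bin_ratioS R n j.+1 jn.
rewrite -[j.+1%:R]natr1 in E2 *.
have -> : bin_ratio n j = (n%:R + j%:R + 1) / (n%:R - j%:R) * bin_ratio n j.+1 :> R.
  by apply: (mulfI nj0); rewrite -E1 [RHS]mulrA; congr (_ * _); rewrite [RHS]mulrC divfK.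
have -> : bin_ratio n j.+2 = (n%:R - j%:R - 1) / (n%:R + j%:R + 2) * bin_ratio n j.+1 :> R.
  apply: (mulfI nj1); transitivity ((n%:R - j%:R - 1) * bin_ratio n j.+1 : R); last by field.
  by rewrite (_ : n%:R + j%:R + 2 = n%:R + (j%:R + 1) + 1) ?E2; ring.
rewrite -mulrBl; congr (_ * _); field.
rewrite nj0 nj1 gt_eqF// (_ : _ - _ = (n%:R - j%:R) * (n%:R + j%:R + 2)); last by ring.
by rewrite mulr_gt0//; lra.
Qed.

Lemma bin_ratio_diff_gauss n j : (0 < j)%N -> (j.*2 <= n)%N ->
  `|bin_ratio n j.-1 - bin_ratio n j.+1 - 4 * j%:R / n%:R * expR (- (j%:R ^+ 2 / n%:R))|
  <= 44 * j%:R / (n%:R * Num.sqrt n%:R) :> R.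
Proof.
move=> j0 jn; have n0 : (0 < n)%N by lia.
have jn' : (j <= n)%N by lia.
rewrite bin_ratio_diff//.
have h1 := @bin_ratio_gauss R _ _ n0 jn; have h2 := @sqr_bin_ratio R _ _ jn'.
have h3 := @bin_ratio_le1 R _ _ jn'; have h0 := @bin_ratio_ge0 R n j.
move: h1 h2 h3 h0; move: (bin_ratio n j) (expR _) => r e h1 h2 h3 h0.
have nR : 1 <= n%:R :> R by rewrite ler1n.
have jR : 2 * j%:R <= n%:R :> R by rewrite -natrM ler_nat mul2n.
have j0R : 0 <= j%:R :> R := ler0n _ _.
set s := Num.sqrt n%:R in h1 *.
have s0 : 0 < s by rewrite sqrtr_gt0; lra.
have s2 : s ^+ 2 = n%:R by rewrite sqr_sqrtr//; lra.
have sn : s <= n%:R.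
  have s1 : 1 <= s by rewrite -(@ler_pXn2r _ 2)// ?nnegrE ?(ltW s0)// s2 expr1n.
  by rewrite -s2 expr2 ler_peMl// ltW.
move: (n%:R) (j%:R) nR jR j0R h1 h2 s2 sn => N J nR jR j0R h1 h2 s2 sn.
have N0 : N != 0 by rewrite gt_eqF; lra.
have DE : (N + 1) ^+ 2 - J ^+ 2 >= 3 / 4 * N ^+ 2 by nra.
have D0 : 0 < (N + 1) ^+ 2 - J ^+ 2 by nra.
(* The deviation of the rational prefactor from [4 J / N] is separated from the Gaussian error of
   the ratio. *)
have -> : 2 * J * (2 * N + 1) / ((N + 1) ^+ 2 - J ^+ 2) * r - 4 * J / N * e =
  2 * J * (2 * J ^+ 2 - 3 * N - 2) / (N * ((N + 1) ^+ 2 - J ^+ 2)) * r + 4 * J / N * (r - e).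
  by field; rewrite N0 gt_eqF.
rewrite (le_trans (ler_normD _ _))//.
have b2 : `|4 * J / N * (r - e)| <= 20 * J / (N * s).
  rewrite normrM ger0_norm; last by apply: divr_ge0; lra.
  have -> : 20 * J / (N * s) = 4 * J / N * (5 / s) by field; rewrite N0 gt_eqF.
  by apply: ler_wpM2l => //; apply: divr_ge0; lra.
have b1 : `|2 * J * (2 * J ^+ 2 - 3 * N - 2) / (N * ((N + 1) ^+ 2 - J ^+ 2)) * r|
    <= 24 * J / (N * s).
  apply: (@le_trans _ _ (24 * J / N ^+ 2)); last first.
    apply: ler_wpM2l; first lra.
    by rewrite lef_pV2 ?posrE; nra.
  have -> : 2 * J * (2 * J ^+ 2 - 3 * N - 2) / (N * ((N + 1) ^+ 2 - J ^+ 2)) * r =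
    2 * J / N * (((2 * J ^+ 2 - 3 * N - 2) * r) / ((N + 1) ^+ 2 - J ^+ 2)).
    by field; rewrite N0 gt_eqF.
  have -> : 24 * J / N ^+ 2 = 2 * J / N * (12 / N) by field.
  rewrite normrM ger0_norm; last by apply: divr_ge0; lra.
  apply: ler_wpM2l; first by apply: divr_ge0; lra.
  rewrite normrM normfV (@gtr0_norm _ (_ - _))// ler_pdivrMr//.
  (* The denominator is at least [3 / 4 N^2], so it suffices to bound the numerator by [9 N], which
     follows from [J^2 r <= 2 N] and [r <= 1]. *)
  apply: (@le_trans _ _ (12 / N * (3 / 4 * N ^+ 2))); last first.
    by apply: ler_wpM2l => //; apply: divr_ge0; lra.
  have -> : 12 / N * (3 / 4 * N ^+ 2) = 9 * N by field.
  rewrite ler_norml; apply/andP; split; nra.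
have -> : 44 * J / (N * s) = 24 * J / (N * s) + 20 * J / (N * s).
  by field; rewrite N0 gt_eqF.
exact: lerD.
Qed.

(** Turns the [2^n] error into [O(1/n)] after normalization. The induction step needs
    [(m + 1)^2 <= m (2 m + 1)], which fails at [m = 1]; hence the three base cases. *)
Lemma pow2_bin_central n : n%:R * 2 ^+ n <= 2 * 'C(n.*2, n)%:R :> R.
Proof.
elim: n => [|[|[|n]] ih]; first by rewrite mul0r.
- by rewrite (_ : 'C(1.*2, 1) = 2)%N// expr1; lra.
- by rewrite (_ : 'C(2.*2, 2) = 6)%N// expr2; lra.
set m := n.+2 in ih *.
have mR : 2 <= m%:R :> R by rewrite ler_nat.
have := @bin_centralSr R m; rewrite -[m.+1%:R]natr1 exprS.
move: ih; move: 'C(m.*2, m)%:R 'C(m.+1.*2, m.+1)%:R (2 ^+ m) (exprn_ge0 m (ler0n R 2)).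
move=> a b p p0 ih E.
have m0 : 0 < m%:R + 1 :> R by lra.
rewrite -(ler_pM2l m0) [leRHS]mulrCA E.
apply: (@le_trans _ _ (2 * (2 * m%:R + 1) * (m%:R * p))); last first.
  have -> : 2 * (2 * (2 * m%:R + 1) * a) = 2 * (2 * m%:R + 1) * (2 * a) by ring.
  by rewrite ler_wpM2l//; lra.
have -> : (m%:R + 1) * ((m%:R + 1) * (2 * p)) = (2 * p) * (m%:R + 1) ^+ 2 by ring.
have -> : 2 * (2 * m%:R + 1) * (m%:R * p) = (2 * p) * ((2 * m%:R + 1) * m%:R) by ring.
by rewrite ler_wpM2l ?mulr_ge0//; nra.
Qed.

Lemma ds_count_llt n k : (0 < n)%N ->
  `|ds_count n k / 'C(n.*2, n)%:R - llt_main n k| <= 170 * llt_err n k :> R.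
Proof.
move=> n0; have a0 := @bin_central_gt0 R n.
have nR : 1 <= n%:R :> R by rewrite ler1n.
set s := Num.sqrt n%:R : R.
have s0 : 0 < s by rewrite sqrtr_gt0; lra.
have s2 : s ^+ 2 = n%:R by rewrite sqr_sqrtr//; lra.
have k0 : 0 <= k%:R :> R := ler0n _ _.
have nn0 : n%:R != 0 :> R by rewrite gt_eqF; lra.
pose S : R := if k is k'.+1 then bin_ratio n k'.*2.+1 - bin_ratio n k'.*2.+3 else 0.
have hS : `|ds_count n k / 'C(n.*2, n)%:R - S| <= 26 / n%:R + 77 * k%:R / (n%:R * s).
  have -> : S = mean (fun t : R => 2 * sin t * sin (2 * k%:R * t) *
      (2 + 2 * cos t) ^+ n) / 'C(n.*2, n)%:R.
    rewrite /S; case: k {k0 S} => [|k]; last by rewrite mean_sin_sin_pow /bin_ratio mulrBl.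
    rewrite (@eq_mean _ _ (fun=> 0 * 1)); last by move=> t; rewrite mulr0 mul0r sin0 mulr0 !mul0r.
    by rewrite meanZ ?mul0r//; exact: ct_cst.
  rewrite -mulrBl normrM normfV (gtr0_norm a0) ler_pdivrMr//.
  rewrite -(subrKA (kern_mean n k)) (le_trans (ler_normD _ _))//.
  (* The scale [sqrt n] gives both AM-GM terms the order [k n^(-3/2)]. The constants are
     [77 = 56 + 21] and [26 = 18 + 8], with 18 coming from the [2^n] error. *)
  have h2 := @kern_mean_sin R n k s s0.
  have h1 := @ds_count_kern_mean R n k; have hp := pow2_bin_central n.
  apply: le_trans (lerD h1 h2) _.
  have {}hp : 9 * 2 ^+ n <= 'C(n.*2, n)%:R * (18 / n%:R) :> R.
    have -> : 'C(n.*2, n)%:R * (18 / n%:R) = 9 * (2 * 'C(n.*2, n)%:R) / n%:R :> R by ring.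
    rewrite ler_pdivlMr; last lra.
    by rewrite -mulrA ler_wpM2l// [_ * n%:R]mulrC.
  apply: le_trans (lerD hp (lexx _)) _.
  rewrite -mulrDr [leRHS]mulrC ler_wpM2l ?(ltW a0)//.
  have -> : 26 / n%:R + 77 * k%:R / (n%:R * s) =
    18 / n%:R + ((8 + 56 * k%:R / s) / n%:R + 21 * k%:R * s / (n%:R * n%:R)) :> R.
    by rewrite -s2; field; rewrite gt_eqF.
  rewrite lerD2l lerD//.
    apply: ler_wpM2l; first by rewrite addr_ge0// divr_ge0 ?mulr_ge0// ltW.
    by rewrite lef_pV2 ?posrE; lra.
  apply: ler_wpM2l; first by rewrite mulr_ge0 ?mulr_ge0// ltW.
  by rewrite lef_pV2 ?posrE; nra.
rewrite -(subrKA S) (le_trans (ler_normD _ _))//.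
have -> : 170 * llt_err n k = (26 / n%:R + 77 * k%:R / (n%:R * s)) +
    (144 / n%:R + 93 * k%:R / (n%:R * s)) :> R.
  by rewrite /llt_err -/s; field; rewrite nn0 gt_eqF.
apply: lerD => {hS}//.
case: k k0 @S => [|k] k0 S.
  rewrite /S /llt_main mulr0 !mul0r subr0 normr0 addr_ge0 ?divr_ge0//; nra.
have KR : 1 <= k.+1%:R :> R by rewrite ler1n.
have ns0 : 0 < n%:R * s by rewrite mulr_gt0//; lra.
(* In the first case the Gaussian comparison applies at [j = 2 (k + 1)]. Otherwise [k + 1] exceeds
   [n / 4], and both binomial ratios and the main term are separately [O(1/n)]. *)
have [kn|kn] := leqP (4 * k.+1) n.
  have := @bin_ratio_diff_gauss n (k.+1.*2) isT _; rewrite doubleS => /(_ ltac:(lia)) /= h.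
  have -> : llt_main n k.+1 =
     4 * k.*2.+2%:R / n%:R * expR (- (k.*2.+2%:R ^+ 2 / n%:R)).
    rewrite -doubleS -mul2n natrM /llt_main; congr (_ * expR _); by field.
  apply: le_trans h _; rewrite -doubleS -mul2n natrM -/s.
  have -> : 44 * (2 * k.+1%:R) / (n%:R * s) = 88 * k.+1%:R / (n%:R * s) by ring.
  apply: (@le_trans _ _ (93 * k.+1%:R / (n%:R * s))); last by rewrite lerDr divr_ge0.
  by apply: ler_wpM2r; [rewrite invr_ge0 ltW|lra].
have knR : n%:R <= 4 * k.+1%:R :> R by rewrite -natrM ler_nat ltnW.
apply: (@le_trans _ _ (144 / n%:R)); last first.
  by rewrite lerDl; apply: divr_ge0; [exact: mulr_ge0|exact: ltW].
have b1 : llt_main n k.+1 <= 8 / n%:R.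
  have h := mulr_expRN_le1 (4 * k.+1%:R ^+ 2 / n%:R : R).
  have -> : llt_main n k.+1 =
    (4 * k.+1%:R ^+ 2 / n%:R) * expR (- (4 * k.+1%:R ^+ 2 / n%:R)) * (2 / k.+1%:R).
    by rewrite /llt_main !mulNr; field; rewrite nn0 gt_eqF//; lra.
  apply: le_trans (_ : 1 * (2 / k.+1%:R) <= _).
    by rewrite ler_wpM2r// divr_ge0.
  by rewrite mul1r ler_pdivrMr ?ltr0n// mulrAC ler_pdivlMr; lra.
have b10 : 0 <= llt_main n k.+1 :> R.
  by rewrite /llt_main mulr_ge0 ?expR_ge0// divr_ge0 ?mulr_ge0.
have r32 i : (k < i)%N -> bin_ratio n i <= 32 / n%:R :> R.
  move=> ki; have [ni|ni] := ltnP n i.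
    rewrite /bin_ratio bin_small ?mul0r ?divr_ge0//; lia.
  have h := @sqr_bin_ratio R n i ni.
  have iR : k.+1%:R <= i%:R :> R by rewrite ler_nat.
  have i2 : n%:R ^+ 2 <= 16 * i%:R ^+ 2 :> R by nra.
  have b0 := bin_ratio_ge0 n i : 0 <= _ :> R.
  rewrite ler_pdivlMr; last lra.
  rewrite -(ler_pM2l (_ : 0 < n%:R)); last lra.
  apply: le_trans (_ : bin_ratio n i * n%:R ^+ 2 <= _); first by rewrite expr2; lra.
  by apply: le_trans (ler_wpM2l b0 i2) _; lra.
have := r32 k.*2.+1 ltac:(lia); have := r32 k.*2.+3 ltac:(lia).
have := @bin_ratio_ge0 R n k.*2.+1; have := @bin_ratio_ge0 R n k.*2.+3.
rewrite /S; have -> : 144 / n%:R = 32 / n%:R + 8 / n%:R + 104 / n%:R :> R by ring.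
have : 0 <= 104 / n%:R :> R by rewrite divr_ge0.
move: (bin_ratio _ _) (bin_ratio _ _) (llt_main _ _) (32 / _) (8 / _) (104 / _) b1 b10 => *.
rewrite ler_norml; lra.
Qed.

End local_limit.

(** * Local limit for partitions with [max (lambda_1, lambda'_1) = n] *)

Section max_part_llt.
Context {R : realType}.
Implicit Types (n k : nat).

Definition max_gf n : {poly R} :=
  if n is n'.+1 then central_gf R n - central_gf R n' else 1.

Lemma bin_central_pred n :
  'C(n.*2, n)%:R = (n%:R + 1) / (2 * (2 * n%:R + 1)) * 'C(n.+1.*2, n.+1)%:R :> R.
Proof.
have d : 2 * n%:R + 1 != 0 :> R by rewrite -natrM natr1 pnatr_eq0.
have := @bin_centralSr R n; set a := 'C(n.+1.*2, _)%:R => E.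
by rewrite mulrAC E; field.
Qed.

Lemma llt_main_step n k :
  `|llt_main n.+1 k - llt_main n.+2 k| <= 8 * k%:R / (n.+1%:R * n.+2%:R) :> R.
Proof.
have n1 : 0 < n.+1%:R :> R by rewrite ltr0n.
have n2 : n.+1%:R + 1 = n.+2%:R :> R by rewrite natr1.
have k0 : 0 <= k%:R :> R := ler0n _ _.
pose g (t : R) := t * expR (- (4 * k%:R ^+ 2 * t)).
have mE m : llt_main m.+1 k = 8 * k%:R * g m.+1%:R^-1 :> R.
  by rewrite /llt_main /g mulrA !mulNr.
(* The function [g] is 1-Lipschitz on [t >= 0] uniformly in [k]: its derivative
   [(1 - c t) exp (- c t)] has modulus at most 1. *)
have lip (t u : R) : 0 <= t -> t <= u -> `|g u - g t| <= u - t.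
  move=> t0 tu; rewrite /g; set c := 4 * k%:R ^+ 2.
  have c0 : 0 <= c by rewrite mulr_ge0// exprn_ge0.
  have ctu : c * t <= c * u by rewrite ler_wpM2l.
  have e1 : expR (- (c * u)) <= expR (- (c * t)) by rewrite ler_expR lerN2.
  have e2 := expRN_sub_le ctu; have e3 := mulr_expRN_le1 (c * t).
  have e4 : expR (- (c * u)) <= 1 by rewrite -[leRHS]expR0 ler_expR oppr_le0 mulr_ge0//; lra.
  have e5 := expR_ge0 (- (c * u)).
  move: (expR (- (c * u))) (expR (- (c * t))) e1 e2 e3 e4 e5 => eu et e1 e2 e3 e4 e5.
  rewrite ler_norml; apply/andP; split; last by nra.
  have h : t * (et - eu) <= t * (et * (c * u - c * t)) by rewrite ler_wpM2l.
  have h' : t * (et * (c * u - c * t)) <= u - t.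
    have -> : t * (et * (c * u - c * t)) = (c * t * et) * (u - t) by ring.
    by rewrite ler_piMl//; lra.
  have : 0 <= (u - t) * eu by rewrite mulr_ge0//; lra.
  lra.
rewrite !mE -mulrBr normrM ger0_norm; last by rewrite mulr_ge0.
apply: ler_wpM2l; first by rewrite mulr_ge0.
apply: le_trans (lip _ _ _ _) _.
- by rewrite invr_ge0 ltW// -n2 ltr_wpDr.
- by rewrite lef_pV2 ?posrE -?n2; lra.
rewrite -n2 le_eqVlt; apply/orP; left; apply/eqP; field.
by rewrite !gt_eqF//; lra.
Qed.

Lemma max_llt n k :
  `|(max_gf n.+2)`_k / (max_gf n.+2).[1] - llt_main n.+2 k| <= 1500 * llt_err n.+2 k.
Proof.
rewrite /max_gf coefB hornerD hornerN !central_gf1E.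
have h2 := @ds_count_llt R n.+2 k isT; have h1 := @ds_count_llt R n.+1 k isT.
rewrite /ds_count in h1 h2.
have h12 := llt_main_step n k.
have a2 := @bin_central_gt0 R n.+2; have a1 := @bin_central_gt0 R n.+1.
have aE := bin_central_pred n.+1.
move: a2 a1 aE h1 h2; set A2 := 'C(n.+2.*2, _)%:R; set A1 := 'C(n.+1.*2, _)%:R.
move=> a2 a1 aE h1 h2.
have n1 : 1 <= n.+1%:R :> R by rewrite ler1n.
have n2 : n.+2%:R = n.+1%:R + 1 :> R by rewrite natr1.
have k0 : 0 <= k%:R :> R := ler0n _ _.
pose q : R := (n.+1%:R + 1) / (2 * (2 * n.+1%:R + 1)).
have q0 : 0 <= q by apply: divr_ge0; lra.
have q1 : q <= 1 / 2 by rewrite /q ler_pdivrMr; lra.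
have qa : A1 = q * A2 by [].
set B2 := (central_gf R n.+2)`_k in h2 *; set B1 := (central_gf R n.+1)`_k in h1 *.
(* With [q = A1 / A2] the new law is the affine combination of the two box laws with weights
   [1 / (1 - q)] and [- q / (1 - q)], bounded since [q <= 1 / 2]. *)
have -> : (B2 - B1) / (A2 - A1) - llt_main n.+2 k =
  ((B2 / A2 - llt_main n.+2 k) - q * (B1 / A1 - llt_main n.+1 k)
   - q * (llt_main n.+1 k - llt_main n.+2 k)) / (1 - q).
  have A20 : A2 != 0 by rewrite gt_eqF.
  have A10 : A1 != 0 by rewrite gt_eqF.
  have qn : 1 - q != 0 by rewrite gt_eqF//; lra.
  have qn0 : q != 0 by apply: contraNneq A10 => q00; rewrite qa q00 mul0r.
  rewrite qa; field; rewrite qn A20 qn0 /=.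
  by rewrite -[X in X - _]mul1r -mulrBl mulf_neq0.
rewrite normrM normfV (@gtr0_norm _ (1 - q)) ?ler_pdivrMr; [|lra..].
set e2 := llt_err n.+2 k in h2 *; set e1 := llt_err n.+1 k in h1.
have s1 : 0 < Num.sqrt n.+1%:R :> R by rewrite sqrtr_gt0; lra.
have s2 : 0 < Num.sqrt n.+2%:R :> R by rewrite sqrtr_gt0 ltr0n.
have s1E : Num.sqrt n.+1%:R ^+ 2 = n.+1%:R :> R by rewrite sqr_sqrtr//; lra.
have s2E : Num.sqrt n.+2%:R ^+ 2 = n.+2%:R :> R by rewrite sqr_sqrtr//; lra.
have s12 : Num.sqrt n.+2%:R <= 2 * Num.sqrt n.+1%:R :> R.
  rewrite -(@ler_pXn2r _ 2)// ?nnegrE ?mulr_ge0 ?(ltW s1) ?(ltW s2)// exprMn s1E s2E; lra.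
have e2k : k%:R / (n.+2%:R * Num.sqrt n.+2%:R) <= e2 by rewrite /e2 /llt_err lerDl invr_ge0; lra.
have e20 : 0 <= e2.
  by apply: le_trans e2k; rewrite divr_ge0// mulr_ge0 ?(ltW s2)//; lra.
have e12 : e1 <= 4 * e2.
  rewrite /e1 /e2 /llt_err mulrDr lerD//.
    rewrite mulrCA; apply: ler_wpM2l => //.
    rewrite -[leRHS]invrK lef_pV2 ?posrE ?invr_gt0 ?mulr_gt0 ?invr_gt0 ?mulr_gt0//; [|lra..].
    rewrite invfM invrK; nra.
  rewrite -[leRHS]invrK lef_pV2 ?posrE ?invr_gt0 ?mulr_gt0 ?invr_gt0//; [|lra..].
  rewrite invfM invrK; lra.
have dk : `|llt_main n.+1 k - llt_main n.+2 k| <= 32 * e2.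
  apply: le_trans h12 _.
  apply: (@le_trans _ _ (32 * (k%:R / (n.+2%:R * Num.sqrt n.+2%:R)))); last first.
    by rewrite ler_wpM2l.
  have -> : 8 * k%:R / (n.+1%:R * n.+2%:R) = k%:R * (8 / (n.+1%:R * n.+2%:R)) :> R by ring.
  rewrite [leRHS]mulrCA; apply: ler_wpM2l => //.
  rewrite -[leRHS]invrK -[leLHS]invrK lef_pV2 ?posrE;
    rewrite ?invr_gt0 ?mulr_gt0 ?invr_gt0 ?mulr_gt0//; [|lra..].
  rewrite invf_div invfM invrK; nra.
apply: le_trans (ler_normB _ _) _.
apply: le_trans (lerD (ler_normB _ _) (lexx _)) _.
rewrite !(normrM q) (ger0_norm q0).
have p1 := ler_pM q0 (normr_ge0 _) q1 (le_trans h1 (ler_wpM2l (ler0n R 170) e12)).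
have p2 := ler_pM q0 (normr_ge0 _) q1 dk.
nra.
Qed.

End max_part_llt.

(** * Exact factorial moments *)

Section moments.
Context {R : realType}.
Implicit Types (n : nat).

(** In [central_gfS] the factor ['X - 1] vanishes at 1, so only its own derivative survives, leaving
    a convolution of central binomials. *)
Lemma central_gf_deriv1 n : ((central_gf R n.+1)^`()).[1] = 4 ^+ n.
Proof.
rewrite central_gfS derivD derivM derivB derivX derivC subr0 mul1r.
rewrite -polyC_natr derivC add0r !hornerE subrr mul0r addr0 horner_sum.
rewrite -(natrX _ 4) -conv_bin_central natr_sum; apply: eq_bigr => i _.
by rewrite hornerM central_gf1E natrM -polyC_natr hornerC.
Qed.

(** In [central_gfSS] the double zero [('X - 1)^2] contributes only [2 C(2n, n)] to the second
    derivative at 1; the resulting recursion is solved by [bin_centralSr]. *)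
Lemma central_gf_deriv2 n : ((central_gf R n.+1)^`(2)).[1] = n%:R * 'C(n.*2, n)%:R.
Proof.
elim: n => [|n ih].
  rewrite central_gf1 /= (_ : (1 + 'X)^`() = 1%:P) ?derivC ?hornerC ?mul0r//.
  by rewrite derivD derivX -polyC1 derivC add0r.
rewrite central_gfSS.
pose v : {poly R} := 'X - 1%:P.
have dv : v^`() = 1%:P by rewrite derivXsubC.
have v1 : v.[1] = 0 by rewrite hornerXsubC subrr.
have -> : 4 * central_gf R n.+1 + ('X - 1) ^+ 2 * central_gf R n +
     ('C(n.+2.*2, n.+2)%:R - 4 * 'C(n.+1.*2, n.+1)%:R) =
   4 *: central_gf R n.+1 + v * v * central_gf R n +
     ('C(n.+2.*2, n.+2)%:R - 4 * 'C(n.+1.*2, n.+1)%:R)%:P.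
  by rewrite polyCB polyCM !polyC_natr -mul_polyC polyC_natr /v polyC1 expr2.
clearbody v; move: ih; rewrite !derivnS !derivn0 => ih.
rewrite !(derivD, derivZ, derivC, derivM, dv, addr0, mul0r, mulr0, add0r).
rewrite !hornerE ih central_gf1E v1.
by have := @bin_centralSr R n; rewrite natr1 /=; lra.
Qed.

Lemma max_gf_deriv1 n : ((max_gf n.+2 : {poly R})^`()).[1] = 3 * 4 ^+ n.
Proof. by rewrite derivB hornerD hornerN !central_gf_deriv1 exprS; ring. Qed.

Lemma max_gf_deriv2 n : ((max_gf n.+2 : {poly R})^`(2)).[1] =
  n.+1%:R * 'C(n.+1.*2, n.+1)%:R - n%:R * 'C(n.*2, n)%:R.
Proof. by rewrite derivnB hornerD hornerN !central_gf_deriv2. Qed.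

Lemma bin_central_sqrt n : (0 < n)%N ->
  Num.sqrt pi * Num.sqrt n%:R <= (4 ^+ n / 'C(n.*2, n)%:R : R)
    <= Num.sqrt pi * Num.sqrt n%:R + 1.
Proof.
move=> n0; have /andP[lo up] := @wallis_bounds R n n0.
have n1 : 1 <= n%:R :> R by rewrite ler1n.
have pi0 := @pi_gt0 R; have pi4 : pi <= 4 :> R.
  by have := @pihalf_lt2 R; lra.
have pi1 : 1 <= pi :> R by have := @pi_ge2 R; lra.
rewrite -sqrtrM ?(ltW pi0)//; set w := _ / _ in lo up *; set s := Num.sqrt _.
have w0 : 0 <= w by rewrite divr_ge0// exprn_ge0.
have s0 : 0 <= s by rewrite sqrtr_ge0.
have s2 : s ^+ 2 = pi * n%:R by rewrite sqr_sqrtr// mulr_ge0// ltW.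
have s1 : 1 <= s.
  rewrite -(@ler_pXn2r _ 2)// ?nnegrE// s2 expr1n; nra.
by apply/andP; split; rewrite -(@ler_pXn2r _ 2)// ?nnegrE ?addr_ge0//; nra.
Qed.

End moments.

(** * From the local limit to distribution functions *)

Section rayleigh_cdf.
Context {R : realType}.
Implicit Types (n k : nat).

Definition gauss n k : R := expR (- (4 * k%:R ^+ 2 / n%:R)).

(** The exponent grows by [u = (8 k + 4) / n] from [k] to [k + 1], so the decrement of [gauss] lies
    between [u * gauss n k.+1] and [u * gauss n k]. *)
Lemma llt_main_telescope n k : (0 < n)%N ->
  `|llt_main n k - (gauss n k - gauss n k.+1)| <= (8 * k%:R + 4) ^+ 2 / n%:R ^+ 2 + 4 / n%:R.
Proof.
move=> n0; set g := gauss n; have nR : 1 <= n%:R :> R by rewrite ler1n.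
have k0 : 0 <= k%:R :> R := ler0n _ _.
have nn : n%:R != 0 :> R by rewrite gt_eqF; lra.
pose u : R := (8 * k%:R + 4) / n%:R; pose w : R := 8 * k%:R / n%:R.
have w0 : 0 <= w by apply: divr_ge0; lra.
have wu : u = w + 4 / n%:R by rewrite /u /w; field.
have u0 : 0 <= u by apply: divr_ge0; lra.
have n4 : 0 <= 4 / n%:R :> R by apply: divr_ge0; lra.
have -> : llt_main n k = w * g k by rewrite /llt_main /g /gauss !mulNr.
have -> : (8 * k%:R + 4) ^+ 2 / n%:R ^+ 2 = u ^+ 2 :> R by rewrite /u expr_div_n.
have gS : 4 * k.+1%:R ^+ 2 / n%:R = 4 * k%:R ^+ 2 / n%:R + u :> R.
  by rewrite -natr1 /u; field.
have gu : 4 * k%:R ^+ 2 / n%:R <= 4 * k.+1%:R ^+ 2 / n%:R :> R by rewrite gS lerDl.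
have g1 : g k <= 1 by rewrite -[leRHS]expR0 ler_expR oppr_le0 divr_ge0// mulr_ge0// sqr_ge0.
have up := expRN_sub_le gu; rewrite -/(g k) -/(g k.+1) in up.
have up' : g k - g k.+1 <= g k * u by rewrite (le_trans up)// gS addrAC subrr add0r.
have lo : g k.+1 * u <= g k - g k.+1.
  have -> : g k = g k.+1 * expR u.
    by rewrite /g /gauss -expRD; congr expR; rewrite gS; ring.
  rewrite -[X in _ - X]mulr1 -mulrBr ler_wpM2l ?expR_ge0//.
  by have := expR_ge1Dx u; lra.
have g0 : 0 <= g k.+1 by exact: expR_ge0.
have g0' : 0 <= g k by exact: expR_ge0.
clearbody g u w; rewrite ler_norml; apply/andP; split; nra.
Qed.

(** Up to [k = K], with [K] the integer part of [x sqrt n], each term is within [B / n] of a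
    telescoping difference. The sum has [O(sqrt n)] terms and telescopes to [1 - gauss n K.+1],
    where [K + 1] is within 1 of [x sqrt n]. *)
Lemma llt_sum_le (p : nat -> nat -> R) (C : R) (N : nat) (x : R) :
  0 <= C -> 0 <= x ->
  (forall n k, (N < n)%N -> `|p n k - llt_main n k| <= C * llt_err n k) ->
  exists D, forall n, (N < n)%N ->
    `|\sum_(k < (Num.truncn (x * Num.sqrt n%:R)).+1) p n k -
      (1 - expR (- (4 * x ^+ 2)))| <= D / Num.sqrt n%:R.
Proof.
move=> C0 x0 pC; pose B := C * (x + 1) + (8 * x + 4) ^+ 2 + 4.
exists ((x + 1) * B + 4 * (2 * x + 1)) => n Nn.
have n0 : (0 < n)%N by lia.
have nR : 1 <= n%:R :> R by rewrite ler1n.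
set s := Num.sqrt n%:R : R.
have s0 : 0 < s by rewrite sqrtr_gt0; lra.
have s2 : n%:R = s ^+ 2 :> R by rewrite sqr_sqrtr//; lra.
have s1 : 1 <= s by rewrite -(@ler_pXn2r _ 2)// ?nnegrE ?(ltW s0)// -s2 expr1n.
have sn : s != 0 by rewrite gt_eqF.
have /andP[Kx xK] := truncn_itv (mulr_ge0 x0 (ltW s0)).
set K := Num.truncn _ in Kx xK *.
pose g := gauss n.
have B0 : 0 <= B by rewrite /B !addr_ge0 ?mulr_ge0 ?sqr_ge0//; lra.
have term k : (k <= K)%N -> `|p n k - (g k - g k.+1)| <= B / s ^+ 2.
  move=> kK; have kx : k%:R <= x * s by rewrite (le_trans _ Kx)// ler_nat.
  have k0 : 0 <= k%:R :> R := ler0n _ _.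
  have h1 := pC n k Nn; have h2 := llt_main_telescope k n0; rewrite -/g in h2.
  rewrite -(subrKA (llt_main n k)) (le_trans (ler_normD _ _))//.
  apply: le_trans (lerD h1 h2) _; rewrite /llt_err -/s s2.
  have -> : B / s ^+ 2 = C * (x * s / (s ^+ 2 * s) + (s ^+ 2)^-1) +
     (((8 * x + 4) * s) ^+ 2 / (s ^+ 2) ^+ 2 + 4 / s ^+ 2).
    by rewrite /B; field.
  apply: lerD.
    by rewrite ler_wpM2l// lerD2r ler_wpM2r// invr_ge0 mulr_ge0 ?sqr_ge0// ltW.
  rewrite lerD2r ler_wpM2r ?invr_ge0 ?exprn_ge0 ?(ltW s0)// lerXn2r ?nnegrE//; nra.
have tele m : \sum_(k < m) (g k - g k.+1) = 1 - g m.
  elim: m => [|m ih]; last by rewrite big_ord_recr/= ih; ring.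
  by rewrite big_ord0 /g /gauss expr0n/= mulr0 mul0r oppr0 expR0 subrr.
have sumle : `|\sum_(k < K.+1) p n k - (1 - g K.+1)| <= (x + 1) * B / s.
  rewrite -tele -sumrB (le_trans (ler_norm_sum _ _ _))//.
  apply: (@le_trans _ _ (\sum_(k < K.+1) B / s ^+ 2)).
    by apply: ler_sum => k _; apply: term; rewrite -ltnS.
  rewrite sumr_const card_ord -[leLHS]mulr_natl -natr1.
  have -> : (x + 1) * B / s = ((x + 1) * s) * (B / s ^+ 2) by field.
  rewrite ler_wpM2r ?divr_ge0 ?sqr_ge0//; nra.
have tail : `|g K.+1 - expR (- (4 * x ^+ 2))| <= 4 * (2 * x + 1) / s.
  have Kx2 : x ^+ 2 <= K.+1%:R ^+ 2 / s ^+ 2.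
    rewrite -expr_div_n lerXn2r ?nnegrE ?divr_ge0 ?(ltW s0)//.
    by rewrite ler_pdivlMr// ltW.
  have h4 : 4 * x ^+ 2 <= 4 * K.+1%:R ^+ 2 / n%:R by rewrite s2 -mulrA ler_wpM2l.
  have h := expRN_sub_le h4; rewrite -/(g K.+1) in h.
  have hle : g K.+1 <= expR (- (4 * x ^+ 2)) by rewrite ler_expR lerN2.
  rewrite distrC ger0_norm ?subr_ge0// (le_trans h)//.
  apply: (@le_trans _ _ (4 * K.+1%:R ^+ 2 / n%:R - 4 * x ^+ 2)).
    apply: ler_piMl; first by rewrite subr_ge0.
    by rewrite -[leRHS]expR0 ler_expR oppr_le0; apply: mulr_ge0 => //; exact: sqr_ge0.
  rewrite lerBlDr s2.
  have -> : 4 * (2 * x + 1) / s + 4 * x ^+ 2 = (4 * (2 * x + 1) * s + 4 * x ^+ 2 * s ^+ 2) / s ^+ 2.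
    by field.
  apply: ler_wpM2r; first by rewrite invr_ge0 sqr_ge0.
  have : K.+1%:R ^+ 2 <= (x * s + 1) ^+ 2 :> R.
    by rewrite lerXn2r ?nnegrE ?addr_ge0 ?mulr_ge0 ?(ltW s0)// -natr1 lerD2r.
  nra.
rewrite -(subrKA (1 - g K.+1)) (le_trans (ler_normD _ _))//.
have -> : ((x + 1) * B + 4 * (2 * x + 1)) / s = (x + 1) * B / s + 4 * (2 * x + 1) / s by field.
apply: lerD => //.
by rewrite (_ : _ - _ = - (g K.+1 - expR (- (4 * x ^+ 2)))) ?normrN//; ring.
Qed.

Lemma llt_sum_cvg (p : nat -> nat -> R) (C : R) (N : nat) (x : R) :
  0 <= C -> 0 <= x ->
  (forall n k, (N < n)%N -> `|p n k - llt_main n k| <= C * llt_err n k) ->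
  (\sum_(k < (Num.truncn (x * Num.sqrt n%:R)).+1) p n k) @[n --> \oo] -->
  1 - expR (- (4 * x ^+ 2)).
Proof.
move=> C0 x0 /(llt_sum_le C0 x0)[D hD].
apply/cvgrPdist_le => e e0; near=> n.
have Nn : (N < n)%N by near: n; exact: nbhs_infty_gt.
rewrite distrC (le_trans (hD n Nn))//.
have De : (D / e) ^+ 2 <= n%:R by near: n; exact: nbhs_infty_ger.
have s0 : 0 < Num.sqrt n%:R :> R by rewrite sqrtr_gt0 ltr0n; lia.
rewrite ler_pdivrMr// mulrC -ler_pdivrMr//.
by rewrite (le_trans (ler_norm _))// -sqrtr_sqr ler_wsqrtr.
Unshelve. all: by end_near. Qed.

End rayleigh_cdf.

(** * The law of the number of self-conjugate hooks *)

Section uniform_on_list.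
Context {R : realType}.
Implicit Types (A U : set intpart) (L : seq intpart).

Lemma counting_seq A L : uniq L -> (forall l, A l <-> l \in L) ->
  counting A = ((size L)%:R : R)%:E.
Proof.
move=> uL AL; have -> : A = [set` [fset x in L]%fset].
  by apply/seteqP; split => l /=; rewrite in_fset/=; [move/AL|move=> ?; apply/AL].
by rewrite /counting asboolT// set_fsetK card_fseq undup_id.
Qed.

Context (A : set intpart) (L : seq intpart).
Context (uL : uniq L) (AL : forall l, A l <-> l \in L) (L0 : (0 < size L)%N).

Lemma uniform_partE U : uniform_part R A U = (((count (mem U) L)%:R / (size L)%:R : R))%:E.
Proof.
rewrite /uniform_part /= /mnormalize /= /mrestr setTI (counting_seq uL AL).
rewrite eqe pnatr_eq0 gtn_eqF//= -size_filter.
rewrite (@counting_seq _ [seq l <- L | mem U l]) ?filter_uniq//.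
move=> l; rewrite mem_filter; split => [[Ul /AL ->]|/andP[Ul /AL Al]].
  by rewrite andbT; exact: mem_set.
by split => //; exact: set_mem.
Qed.

(** The uniform law as an average of Dirac masses along the list, which makes integrals finite
    sums. *)
Let m (k : nat) : {measure set intpart -> \bar R} :=
  mscale ((size L)%:R^-1)%:nng (dirac (nth empty_part L k)).

Let uniform_part_msum U : uniform_part R A U = msum m (size L) U.
Proof.
rewrite uniform_partE /msum /m /mscale/=.
under eq_bigr do rewrite /mscale/= diracE -EFinM.
rewrite sumEFin -mulr_sumr mulrC; congr (_%:E); congr (_ * _).
rewrite -sum1_count natr_sum big_mkcond (big_nth empty_part) big_mkord.
by apply: eq_bigr => i _; case: ifP => /= ->.
Qed.

Lemma integral_uniform_part (f : intpart -> R) : (forall l, 0 <= f l) ->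
  (\int[uniform_part R A]_l (f l)%:E)%E = ((\sum_(l <- L) f l) / (size L)%:R)%:E.
Proof.
move=> f0; rewrite (eq_measure_integral (msum m (size L))); last first.
  by move=> U _ _; exact: uniform_part_msum.
have fE l : [set: intpart] l -> (0 <= (f l)%:E)%E by rewrite lee_fin.
rewrite ge0_integral_measure_sum//.
rewrite (big_nth empty_part) big_mkord mulrC mulr_sumr -sumEFin; apply: eq_bigr => i _.
by rewrite ge0_integral_mscale ?integral_dirac ?diracT ?mul1e.
Qed.

Let N : R := (size L)%:R.
Let mean1 : R := (\sum_(l <- L) (ds l)%:R) / N.

Lemma expectation_ds : ('E_(uniform_part R A)[ds_rv R])%E = mean1%:E.
Proof. by rewrite unlock integral_uniform_part// => l; exact: ler0n. Qed.

Lemma variance_ds : ('V_(uniform_part R A)[ds_rv R])%E =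
  ((\sum_(l <- L) (ds l)%:R ^+ 2) / N - mean1 ^+ 2)%:E.
Proof.
rewrite /variance unlock expectation_ds/= unlock.
rewrite (integral_uniform_part
    (f := fun l => ((ds l)%:R - mean1) * ((ds l)%:R - mean1))); last first.
  by move=> l; rewrite -expr2 sqr_ge0.
congr (_%:E); have N0 : N != 0 by rewrite pnatr_eq0 -lt0n.
have M : \sum_(l <- L) (ds l)%:R = mean1 * N by rewrite divfK.
have -> : \sum_(l <- L) ((ds l)%:R - mean1) * ((ds l)%:R - mean1) =
    \sum_(l <- L) (ds l)%:R ^+ 2 - 2 * mean1 * (\sum_(l <- L) (ds l)%:R) + mean1 ^+ 2 * N.
  rewrite /N -sum1_size natr_sum !mulr_sumr -sumrB -big_split/=.
  by apply: eq_bigr => l _; ring.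
by rewrite M -/N; move: N mean1 N0 => n1 m1 n0; field.
Qed.

Lemma pmf_ds k : pmf (ds_rv R : {RV (uniform_part R A) >-> R}) k%:R =
  (count (fun l : intpart => ds l == k) L)%:R / N.
Proof.
rewrite /pmf uniform_partE/=; congr (_%:R / _); apply: eq_count => l /=.
by rewrite -(@eqr_nat R); apply/idP/eqP => [/set_mem//|e]; exact: mem_set.
Qed.

Lemma cdf_ds n x : (0 < n)%N ->
  cdf ((Num.sqrt n%:R)^-1 \o* ds_rv R : {RV (uniform_part R A) >-> R}) x =
  if 0 <= x then
    (\sum_(k < (Num.truncn (x * Num.sqrt n%:R)).+1)
      ((count (fun l : intpart => ds l == k) L)%:R / N))%:E
  else 0%E.
Proof.
move=> n0; have s0 : 0 < Num.sqrt n%:R :> R by rewrite sqrtr_gt0 ltr0n.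
rewrite /cdf /distribution /pushforward uniform_partE.
have memE : mem (((Num.sqrt n%:R)^-1 \o* ds_rv R) @^-1` `]-oo, x]%classic) =1
    (fun l : intpart => (ds l)%:R <= x * Num.sqrt n%:R).
  by move=> l /=; apply/idP/idP => [/set_mem|h]; [|apply: mem_set];
    rewrite /= in_itv/= /ds_rv ler_pdivrMr.
rewrite (eq_count memE); case: ifPn => x0; last first.
  rewrite (@eq_count _ _ pred0) ?count_pred0 ?mul0r// => l /=.
  apply/negbTE; rewrite -ltNge (lt_le_trans _ (ler0n _ _))// pmulr_llt0// ltNge//.
congr (_%:E); rewrite -mulr_suml; congr (_ / _).
have xs : 0 <= x * Num.sqrt n%:R by rewrite mulr_ge0// ltW.
set K := Num.truncn _.
have -> : count (fun l : intpart => (ds l)%:R <= x * Num.sqrt n%:R) L =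
    count (fun l : intpart => (ds l < K.+1)%N) L.
  by apply: eq_count => l; rewrite ltnS truncn_ge_nat.
rewrite -natr_sum; congr (_%:R); rewrite -sum1_count.
under [RHS]eq_bigr do rewrite -sum1_count big_mkcond.
rewrite exchange_big/= big_mkcond; apply: eq_bigr => l _.
case: ltnP => lK.
  by rewrite (bigD1 (Ordinal lK))//= eqxx big1// => i; rewrite -val_eqE/= eq_sym => /negbTE ->.
by rewrite big1// => i _; case: eqP => // e; move: lK; rewrite e leqNgt ltn_ord.
Qed.

End uniform_on_list.

Section partition_lists.
Context {R : realType}.
Implicit Types (n : nat) (L : seq intpart).

Definition box_seq n : seq intpart := pmap insub (hook_parts n n n).

Lemma mem_box_seq n l : box_part n l <-> l \in box_seq n.
Proof.
rewrite mem_pmap_sub mem_hook_parts// partsP/= andbC.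
by split => [[-> ->]|/andP[]].
Qed.

Lemma uniq_box_seq n : uniq (box_seq n).
Proof. exact/pmap_sub_uniq/uniq_hook_parts. Qed.

Definition max_seq n : seq intpart :=
  if n is n'.+1 then [seq l <- box_seq n | l \notin box_seq n'] else box_seq 0.

Lemma mem_max_seq n l : max_part n l <-> l \in max_seq n.
Proof.
case: n => [|n]; first rewrite -mem_box_seq /max_part/box_part/= conj_part1; first lia.
rewrite mem_filter; split.
  move=> ln; apply/andP; split; last by apply/mem_box_seq/max_part_sub_box.
  by apply/negP => /mem_box_seq; move: ln; rewrite /max_part /box_part/= conj_part1; lia.
move=> /andP[/negP nl /mem_box_seq]; rewrite /max_part /box_part/= conj_part1 => -[h1 h2].
suff : ~~ ((size l <= n)%N && (part l 1 <= n)%N) by lia.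
by apply/negP => /andP[h3 h4]; apply: nl; apply/mem_box_seq.
Qed.

Lemma uniq_max_seq n : uniq (max_seq n).
Proof. by case: n => [|n]; rewrite ?filter_uniq// uniq_box_seq. Qed.

Definition ds_gf L : {poly R} := \sum_(l <- L) 'X^(ds l).

Lemma ds_gf_box n : ds_gf (box_seq n) = central_gf R n.
Proof.
rewrite /ds_gf -(big_map val xpredT (fun s : seq nat => 'X^(ds s))).
apply: perm_big; apply: uniq_perm.
- by rewrite map_inj_uniq ?uniq_box_seq//; exact: val_inj.
- exact: uniq_hook_parts.
move=> s; apply/mapP/idP => [[l lL ->]|sL].
  by move: lL; rewrite mem_pmap_sub.
have ps : is_part s by move: sL; rewrite mem_hook_parts// => /andP[].
by exists (IntPart ps) => //; rewrite mem_pmap_sub.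
Qed.

Lemma ds_gf_max n : ds_gf (max_seq n) = max_gf n.
Proof.
case: n => [|n]; first by rewrite ds_gf_box /max_gf central_gf0.
have pe : perm_eq [seq l <- box_seq n.+1 | l \in box_seq n] (box_seq n).
  apply: uniq_perm; [by rewrite filter_uniq// uniq_box_seq|exact: uniq_box_seq|] => l.
  rewrite mem_filter; case: (boolP (l \in box_seq n)) => //= /mem_box_seq [h1 h2].
  by apply/mem_box_seq; split; rewrite leqW.
rewrite /max_gf -!ds_gf_box /ds_gf -[X in _ - X](perm_big _ pe)/= !big_filter.
by rewrite [X in _ = X - _](bigID (fun l => l \in box_seq n))/= [RHS]addrAC subrr add0r.
Qed.

Lemma ds_gf1 L : (ds_gf L).[1] = (size L)%:R.
Proof.
rewrite /ds_gf horner_sum -sum1_size natr_sum; apply: eq_bigr => l _.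
by rewrite hornerXn expr1n.
Qed.

Lemma coef_ds_gf L k : (ds_gf L)`_k = (count (fun l : intpart => ds l == k) L)%:R.
Proof.
rewrite coef_sum -sum1_count natr_sum [RHS]big_mkcond/=; apply: eq_bigr => l _.
by rewrite coefXn eq_sym; case: eqP.
Qed.

Lemma ds_gf_deriv L : (ds_gf L)^`() = \sum_(l <- L) 'X^((ds l).-1) *+ ds l.
Proof. by rewrite /ds_gf raddf_sum; apply: eq_bigr => l _ /=; rewrite derivXn. Qed.

Lemma ds_gf_deriv1 L : (ds_gf L)^`().[1] = \sum_(l <- L) (ds l)%:R.
Proof.
rewrite ds_gf_deriv horner_sum; apply: eq_bigr => l _.
by rewrite hornerMn hornerXn expr1n.
Qed.

Lemma ds_gf_deriv2 L : (ds_gf L)^`(2).[1] =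
  \sum_(l <- L) (ds l)%:R ^+ 2 - \sum_(l <- L) (ds l)%:R.
Proof.
rewrite !derivnS derivn0 ds_gf_deriv raddf_sum horner_sum -sumrB.
apply: eq_bigr => l _ /=.
rewrite derivMn derivXn !hornerMn hornerXn expr1n.
case: (ds l) => [|d] /=; first by rewrite mulr0n expr0n subrr.
by rewrite -mulrnA -natr1 natrM -[d.+1%:R]natr1; ring.
Qed.

End partition_lists.

Section rayleigh_distribution.
Context {R : realType}.

Let sigma : R := (2 * Num.sqrt 2)^-1.

Let sigma2 : sigma ^+ 2 = 8^-1.
Proof. by rewrite /sigma exprVn exprMn sqr_sqrtr//; congr (_^-1); ring. Qed.

Lemma rayleigh_pdfE (x : R) : 0 <= x ->
  rayleigh_pdf sigma x = 8 * x * expR (- 4 * x ^+ 2).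
Proof.
move=> x0; rewrite /rayleigh_pdf patchE mem_set/= ?in_itv/= ?x0// sigma2.
by congr (_ * expR _); field.
Qed.

Lemma rayleigh_pdf_le0 (x : R) : x <= 0 -> rayleigh_pdf sigma x = 0.
Proof.
rewrite le_eqVlt => /predU1P[->|x0]; first by rewrite rayleigh_pdfE// mulr0 mul0r.
by rewrite /rayleigh_pdf patchE memNset//= in_itv/= andbT => /(lt_le_trans x0); rewrite ltxx.
Qed.

Lemma rayleigh_cdf (x : R) : rayleigh_prob sigma `]-oo, x]%classic =
  (if 0 <= x then 1 - expR (- (4 * x ^+ 2)) else 0)%:E.
Proof.
have neg y : y <= 0 -> rayleigh_prob sigma `]-oo, y]%classic = 0%E.
  move=> y0; rewrite /rayleigh_prob; apply: integral0_eq => z.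
  by rewrite /= in_itv/= => zy; rewrite rayleigh_pdf_le0// (le_trans zy).
case: ifPn => [|/negbTE x0]; last by rewrite neg// ltW// ltNge x0.
rewrite le_eqVlt => /predU1P[<-|x0].
  by rewrite neg// expr0n/= mulr0 oppr0 expR0 subrr.
rewrite /rayleigh_prob.
pose f (y : R) := 8 * y * expR (- 4 * y ^+ 2).
pose F (y : R) := - expR (- 4 * y ^+ 2).
have -> : (\int[lebesgue_measure]_(y in `]-oo, x]) (rayleigh_pdf sigma y)%:E =
    \int[lebesgue_measure]_(y in `[0%R, x]) (f y)%:E)%E.
  rewrite [LHS]integral_mkcond [RHS]integral_mkcond; apply: eq_integral => y _.
  rewrite !patchE !mem_setE !in_itv/=; have [y0|y0] := leP 0 y.
    by case: ifP => //; rewrite rayleigh_pdfE.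
  by case: ifP => // _; rewrite rayleigh_pdf_le0// ltW.
have dF (y : R) : is_derive y 1 F (f y).
  have dq : is_derive y 1 (fun z : R => - 4 * z ^+ 2) (- 8 * y).
    rewrite (_ : (fun _ => _) = (- 4) \*: (@GRing.exp R ^~ 2)); last first.
      by apply/funext.
    by apply: is_derive_eq; rewrite /GRing.scale/=; ring.
  have := is_deriveN (is_derive1_comp (is_derive_expR _) dq).
  by move=> /is_derive_eq; apply; rewrite /f; ring.
have cF : continuous F.
  by move=> t; apply/differentiable_continuous/derivable1_diffP; case: (dF t).
have cf : continuous f.
  refine (@ctM _ (fun y => 8 * y) (fun y => expR (- 4 * y ^+ 2)) _ _); first by cont.
  have -> : (fun t : R => expR (- 4 * t ^+ 2)) = (fun t => - F t).
    by apply/funext => t; rewrite /F opprK.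
  exact: ctN.
rewrite (@continuous_FTC2 _ f F)//.
- by rewrite /F expr0n/= mulr0 expR0 -EFinB; congr (_%:E); rewrite opprK mulNr addrC.
- exact: continuous_subspaceT.
- split; first by move=> t _; case: (dF t).
  + exact/cvg_at_right_filter/cF.
  + exact/cvg_at_left_filter/cF.
- by move=> t _; rewrite derive1E; case: (dF t).
Qed.

End rayleigh_distribution.

Section moment_asymptotics.
Context {R : realType}.
Implicit Types n : nat.

Let sqrt_ge1 (x : R) : 1 <= x -> 1 <= Num.sqrt x.
Proof. by move=> x1; rewrite -sqrtr1 ler_wsqrtr. Qed.

Let sqrt_pi : 1 <= Num.sqrt (pi : R) <= 2.
Proof.
have := @pi_ge2 R; have := @pihalf_lt2 R => h2 h1.
rewrite sqrt_ge1 /=; last lra.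
by rewrite -(@ler_pXn2r _ 2)// ?nnegrE// sqr_sqrtr; lra.
Qed.

Lemma central_gf_mean n :
  `|((central_gf R n.+1)^`()).[1] / (central_gf R n.+1).[1] -
    Num.sqrt pi / 4 * Num.sqrt n.+1%:R| <= 1.
Proof.
rewrite central_gf_deriv1 central_gf1E.
have /andP[] := @bin_central_sqrt R n.+1 isT.
have -> : 4 ^+ n.+1 / 'C(n.+1.*2, n.+1)%:R = 4 * (4 ^+ n / 'C(n.+1.*2, n.+1)%:R) :> R.
  by rewrite exprS mulrA.
by move: (_ / _) => w h1 h2; rewrite ler_norml; lra.
Qed.

Lemma central_gf_mean2 n :
  `|((central_gf R n.+1)^`(2)).[1] / (central_gf R n.+1).[1] - n.+1%:R / 4| <= 1.
Proof.
rewrite central_gf_deriv2 central_gf1E.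
have n0 : 0 <= n%:R :> R := ler0n _ _.
have d0 : 2 * n%:R + 1 != 0 :> R by rewrite gt_eqF//; lra.
have a0 := @bin_central_gt0 R n.+1.
have -> : n%:R * 'C(n.*2, n)%:R / 'C(n.+1.*2, n.+1)%:R - n.+1%:R / 4 =
    - ((n%:R + 1) / (4 * (2 * n%:R + 1))) :> R.
  rewrite bin_central_pred -natr1; move: 'C(n.+1.*2, n.+1)%:R a0 => a a0.
  by field; rewrite d0 gt_eqF.
rewrite normrN ger0_norm; last by apply: divr_ge0; lra.
by rewrite ler_pdivrMr; lra.
Qed.

Lemma max_gf_mean n :
  `|((max_gf n.+2 : {poly R})^`()).[1] / (max_gf n.+2).[1] -
    Num.sqrt pi / 4 * Num.sqrt n.+2%:R| <= 1.
Proof.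
rewrite max_gf_deriv1 /max_gf hornerD hornerN !central_gf1E (bin_central_pred n.+1).
have n0 : 0 <= n%:R :> R := ler0n _ _.
have a0 := @bin_central_gt0 R n.+2.
have /andP[] := @bin_central_sqrt R n.+2 isT.
have nE : n.+2%:R = n%:R + 2 :> R by rewrite -natrD addn2.
have nE1 : n.+1%:R = n%:R + 1 :> R by rewrite natr1.
have s0 : 0 <= Num.sqrt n.+2%:R :> R by rewrite sqrtr_ge0.
have sn : Num.sqrt n.+2%:R <= n.+2%:R :> R.
  rewrite -[leRHS]sqr_sqrtr ?ler0n// expr2 ler_peMr// sqrt_ge1// ler1n.
  by [].
have /andP[p1 p2] := sqrt_pi.
set a := 'C(n.+2.*2, n.+2)%:R; set w := _ / a => h1 h2.
have an0 : a != 0 by rewrite gt_eqF.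
(* Here [w / 4] is the mean for the full box. Removing the smaller box multiplies it by
   [(6 n + 9) / (6 n + 8)], a bounded correction since [w] grows at most linearly. *)
have -> : 3 * 4 ^+ n / (a - (n.+1%:R + 1) / (2 * (2 * n.+1%:R + 1)) * a) =
    w / 4 * (1 + (6 * n%:R + 8)^-1).
  rewrite /w !exprS nE1; field.
  rewrite an0 /= !gt_eqF//; try lra.
  rewrite (_ : _ - _ = (3 * n%:R + 4) * a); last by ring.
  by rewrite mulr_gt0//; lra.
have w0 : 0 <= w by apply: divr_ge0; rewrite ?exprn_ge0.
have h3 : w / 4 * (6 * n%:R + 8)^-1 <= 1 / 2.
  rewrite ler_pdivrMr; last lra.
  have : Num.sqrt pi * Num.sqrt n.+2%:R <= 2 * (n%:R + 2) :> R by rewrite -nE ler_pM ?sqrtr_ge0.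
  lra.
have h4 : 0 <= w / 4 * (6 * n%:R + 8)^-1 by rewrite mulr_ge0 ?invr_ge0//; lra.
by rewrite mulrDr mulr1 ler_norml; lra.
Qed.

Lemma max_gf_mean2 n :
  `|((max_gf n.+2 : {poly R})^`(2)).[1] / (max_gf n.+2).[1] - n.+2%:R / 4| <= 1.
Proof.
rewrite max_gf_deriv2 /max_gf hornerD hornerN !central_gf1E.
rewrite (bin_central_pred n) (bin_central_pred n.+1).
have n0 : 0 <= n%:R :> R := ler0n _ _.
have a0 := @bin_central_gt0 R n.+2.
have nE : n.+2%:R = n%:R + 2 :> R by rewrite -natrD addn2.
have nE1 : n.+1%:R = n%:R + 1 :> R by rewrite natr1.
rewrite nE nE1; move: 'C(n.+2.*2, n.+2)%:R a0 => a a0.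
set t := (X in X - _ / 4); have -> : t - (n%:R + 2) / 4 =
    - ((n%:R + 2) * n%:R / (4 * (3 * n%:R + 4) * (2 * n%:R + 1))).
  rewrite /t; field.
  rewrite !gt_eqF//; try lra.
  rewrite (_ : _ - _ = (3 * n%:R + 4) * a); last by ring.
  by rewrite mulr_gt0//; lra.
rewrite normrN ger0_norm; last by rewrite divr_ge0 ?mulr_ge0//; lra.
by rewrite ler_pdivrMr ?mulr_gt0//; nra.
Qed.

End moment_asymptotics.

Section limit_law.
Context {R : realType}.

(** The common conclusion for both models, from a duplicate-free enumeration, a local limit and the
    first two factorial moments. The threshold [N] excludes small [n], where the estimates need not
    hold. *)
Lemma rayleigh_limit_law (S : nat -> set intpart) (L : nat -> seq intpart)
    (H : nat -> {poly R}) (C : R) (N : nat) :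
  (forall n, uniq (L n)) -> (forall n l, S n l <-> l \in L n) ->
  (forall n, (0 < size (L n))%N) -> (forall n, ds_gf (L n) = H n) -> 0 <= C ->
  (forall n k, (N < n)%N ->
     `|(H n)`_k / (H n).[1] - llt_main n k| <= C * llt_err n k) ->
  (forall n, (N < n)%N ->
     `|(H n)^`().[1] / (H n).[1] - Num.sqrt pi / 4 * Num.sqrt n%:R| <= 1) ->
  (forall n, (N < n)%N ->
     `|(H n)^`(2).[1] / (H n).[1] - n%:R / 4| <= 1) ->
  let P (n : nat) : probability intpart R := uniform_part R (S n) in
  let X (n : nat) : {RV (P n) >-> R} := ds_rv R in
  let sigma : R := (2 * Num.sqrt 2)^-1 in
  [/\ cvg_in_distribution
        (fun n => ((Num.sqrt n%:R)^-1 \o* X n)%R : {RV (P n) >-> R})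
        (rayleigh_prob sigma),
      forall x : R, 0 <= x ->
        rayleigh_pdf sigma x = 8 * x * expR (- 4 * x ^+ 2),
      exists2 e : nat -> R, e =O_\oo (fun=> 1 : R) &
        forall n, ('E_(P n)[X n] =
          (Num.sqrt pi / 4 * Num.sqrt n%:R + e n)%:E)%E,
      exists2 e : nat -> R, e =O_\oo (fun n => Num.sqrt n%:R : R) &
        forall n, ('V_(P n)[X n] = ((1 / 4 - pi / 16) * n%:R + e n)%:E)%E &
      exists C : R, \forall n \near \oo, forall k : nat,
        `| pmf (X n) k%:R
           - 8 * k%:R / n%:R * expR (- 4 * k%:R ^+ 2 / n%:R) |
        <= C * ((k%:R + 1) * n%:R `^ (- (3 / 2)) + n%:R^-1)].
Proof.
move=> uL SL L0 HE C0 llt mn1 mn2 P X sigma; split.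
- move=> x _.
  rewrite -[X in _ --> X]/(rayleigh_prob (2 * Num.sqrt 2)^-1 `]-oo, x]%classic) rayleigh_cdf.
  have cdfE n : (N < n)%N -> cdf ((Num.sqrt n%:R)^-1 \o* X n : {RV (P n) >-> R}) x =
      (if 0 <= x then \sum_(k < (Num.truncn (x * Num.sqrt n%:R)).+1)
         (H n)`_k / (H n).[1] else 0)%:E.
    move=> Nn; rewrite (cdf_ds (uL n) (SL n) (L0 n)); last lia.
    case: ifP => // _; congr (_%:E); apply: eq_bigr => k _.
    by rewrite -HE coef_ds_gf ds_gf1.
  apply/fine_cvgP; split.
    by exists N.+1 => // n Nn; rewrite cdfE.
  have [x0|x0] := boolP (0 <= x).
    apply: cvg_trans (llt_sum_cvg C0 x0 llt); apply: near_eq_cvg.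
    by exists N.+1 => // n Nn; rewrite /comp cdfE// x0.
  have c0 : (fun=> 0 : R) n @[n --> \oo] --> (0 : R) by exact: cvg_cst.
  apply: cvg_trans c0; apply: near_eq_cvg.
  by exists N.+1 => // n Nn; rewrite /comp cdfE// (negbTE x0).
- exact: rayleigh_pdfE.
(* The error is taken to be the exact remainder, so the identity holds for every [n] and only its
   size is asymptotic. *)
- exists (fun n => (H n)^`().[1] / (H n).[1] - Num.sqrt pi / 4 * Num.sqrt n%:R).
    apply/eqO_exP; exists 1 => //; exists N.+1 => // n /= Nn.
    by rewrite normr1 mulr1 mn1.
  move=> n; rewrite (expectation_ds (uL n) (SL n) (L0 n)) -HE ds_gf_deriv1 ds_gf1.
  by congr (_%:E); ring.
- pose M1 n := (H n)^`().[1] / (H n).[1] : R.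
  pose M2 n := (H n)^`(2).[1] / (H n).[1] : R.
  (* [M2] is a factorial moment, hence the extra [M1]. The [O(1)] error of [M1], multiplied by its
     main term of order [sqrt n], produces the [O(sqrt n)] of the variance. *)
  exists (fun n => M2 n + M1 n - M1 n ^+ 2 - (1 / 4 - pi / 16) * n%:R).
    apply/eqO_exP; exists 10 => //; exists N.+1 => // n /= Nn.
    have := mn1 n Nn; have := mn2 n Nn; rewrite -/(M1 n) -/(M2 n).
    have nR : 1 <= n%:R :> R by rewrite ler1n; lia.
    rewrite (ger0_norm (sqrtr_ge0 _)).
    have s2 : Num.sqrt n%:R ^+ 2 = n%:R :> R by rewrite sqr_sqrtr//; lra.
    have s1 : 1 <= Num.sqrt n%:R :> R by rewrite -[leLHS]sqrtr1 ler_wsqrtr.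
    have pi0 := @pi_gt0 R; have pi4 : pi <= 4 :> R by have := @pihalf_lt2 R; lra.
    have q2 : Num.sqrt pi ^+ 2 = pi :> R by rewrite sqr_sqrtr// ltW.
    have q0 : 0 <= Num.sqrt pi :> R by rewrite sqrtr_ge0.
    have q1 : Num.sqrt pi <= 2 :> R by rewrite -(@ler_pXn2r _ 2)// ?nnegrE// q2; lra.
    move: (M1 n) (M2 n) => m1 m2 h2 h1.
    move: (Num.sqrt pi) (Num.sqrt n%:R) q0 q1 q2 s1 s2 h1 => q s q0 q1 q2 s1 s2 h1.
    rewrite -s2 in h2 *; rewrite -q2.
    set d := m1 - q / 4 * s in h1; have -> : m1 = q / 4 * s + d by rewrite /d; ring.
    set f := m2 - s ^+ 2 / 4 in h2; have -> : m2 = s ^+ 2 / 4 + f by rewrite /f; ring.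
    clearbody d f; move: h1 h2; rewrite !ler_norml => /andP[d1 d2] /andP[f1 f2].
    have qs : q * s <= 2 * s by rewrite ler_wpM2r//; lra.
    have qs0 : 0 <= q * s by rewrite mulr_ge0//; lra.
    have -> : s ^+ 2 / 4 + f + (q / 4 * s + d) - (q / 4 * s + d) ^+ 2 -
       (1 / 4 - q ^+ 2 / 16) * s ^+ 2 = f + q * s / 4 + d - (q * s) / 2 * d - d ^+ 2 by field.
    apply/andP; split; nra.
  move=> n; rewrite (variance_ds (uL n) (SL n) (L0 n)); congr (_%:E).
  rewrite /M1 /M2 -HE ds_gf_deriv2 ds_gf_deriv1 ds_gf1; ring.
- exists C; exists N.+1 => // n /= Nn k.
  have n0 : (0 < n)%N by lia.
  have nR : 1 <= n%:R :> R by rewrite ler1n.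
  rewrite (pmf_ds (uL n) (SL n) (L0 n)).
  have := llt n k Nn; rewrite -HE coef_ds_gf ds_gf1 => h; apply: le_trans h _.
  rewrite ler_wpM2l// /llt_err lerD2r.
  have -> : n%:R `^ (- (3 / 2)) = (n%:R * Num.sqrt n%:R)^-1 :> R.
    rewrite powRN (_ : 3 / 2 = 1 + 2^-1); last by field.
    rewrite powRD; last by apply/implyP => _; rewrite gt_eqF//; lra.
    by rewrite powRr1 ?powR12_sqrt//; lra.
  by rewrite ler_wpM2r ?lerDl// invr_ge0 mulr_ge0 ?sqrtr_ge0.
Qed.

End limit_law.

Theorem proposition4p8 (R : realType) (S : nat -> set intpart)
    (hS : S = box_part \/ S = max_part) :
  let P (n : nat) : probability intpart R := uniform_part R (S n) in
  let X (n : nat) : {RV (P n) >-> R} := ds_rv R in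
  let sigma : R := (2 * Num.sqrt 2)^-1 in
  [/\ cvg_in_distribution
        (fun n => ((Num.sqrt n%:R)^-1 \o* X n)%R : {RV (P n) >-> R})
        (rayleigh_prob sigma),
      forall x : R, 0 <= x ->
        rayleigh_pdf sigma x = 8 * x * expR (- 4 * x ^+ 2),
      exists2 e : nat -> R, e =O_\oo (fun=> 1 : R) &
        forall n, ('E_(P n)[X n] =
          (Num.sqrt pi / 4 * Num.sqrt n%:R + e n)%:E)%E,
      exists2 e : nat -> R, e =O_\oo (fun n => Num.sqrt n%:R : R) &
        forall n, ('V_(P n)[X n] = ((1 / 4 - pi / 16) * n%:R + e n)%:E)%E &
      exists C : R, \forall n \near \oo, forall k : nat,
        `| pmf (X n) k%:R
           - 8 * k%:R / n%:R * expR (- 4 * k%:R ^+ 2 / n%:R) |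
        <= C * ((k%:R + 1) * n%:R `^ (- (3 / 2)) + n%:R^-1)].
Proof.
case: hS => ->.
- apply: (@rayleigh_limit_law R box_part box_seq (central_gf R) 170 0).
  + exact: uniq_box_seq.
  + exact: mem_box_seq.
  + move=> n; have [l /mem_box_seq] := box_part_neq0 n; by case: box_seq.
  + exact: ds_gf_box.
  + exact: ler0n.
  + by move=> n k n0; rewrite central_gf1E; exact: ds_count_llt.
  + by case=> // n _; exact: central_gf_mean.
  + by case=> // n _; exact: central_gf_mean2.
(* The threshold is 1 because the local limit is applied to both boxes, and the smaller one must
   have positive side. *)
- apply: (@rayleigh_limit_law R max_part max_seq max_gf 1500 1).
  + exact: uniq_max_seq.
  + exact: mem_max_seq.
  + move=> n; have [l /mem_max_seq] := max_part_neq0 n; by case: max_seq.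
  + exact: ds_gf_max.
  + exact: ler0n.
  + by case=> [|[|n]] k // _; exact: max_llt.
  + by case=> [|[|n]] // _; exact: max_gf_mean.
  + by case=> [|[|n]] // _; exact: max_gf_mean2.
Qed.
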